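(* Let $Q(n)$ be the number of $n$-quasigroups of order $4$ on the set $A=\{0,1,2,3\}$. Then, as $n\to\infty$, $$Q(n) = 3^{n+1}\,2^{2^{n}+1}\left(1 + O\!\left(\frac{1}{3^n}\right)\right).$$
   Context: Let $A=\{0,1,2,3\}$. For a natural number $n$, an $n$-quasigroup (of order $4$) is a pair $(A,q)$ where $q:A^n\to A$ satisfies $q(c)\neq q(c')$ for all $c,c'\in A^n$ that differ in exactly one coordinate. $Q(n)$ denotes the number of different $n$-quasigroups $(A,q)$, i.e. the number of such maps $q$ (not up to equivalence). *)

(* Defs.v *)
From mathcomp Require Import all_boot all_order all_algebra.
From mathcomp Require Import all_classical all_reals all_analysis.

Set Implicit Arguments.
Unset Strict Implicit.
Unset Printing Implicit Defensive.

(* A is 'I_4 and A^n is word n. *)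
Definition word (n : nat) := {ffun 'I_n -> 'I_4}.

Definition differ_in_one (n : nat) (c c' : word n) : bool :=
  #|[set i : 'I_n | c i != c' i]%SET| == 1.

(* Since A is fixed, an n-quasigroup (A, q) is identified with the map q; maps
   are finite functions, so that Q n counts them up to pointwise equality. *)
Definition is_quasigroup (n : nat) (q : {ffun word n -> 'I_4}) : bool :=
  [forall c : word n, forall c' : word n, differ_in_one c c' ==> (q c != q c')].

Definition Q (n : nat) : nat :=
  #|[set q : {ffun word n -> 'I_4} | is_quasigroup q]%SET|.

(* Main.v *)
(* Each of the three partitions of the alphabet into two pairs (the colours) turns a quasigroup
   into a balanced Boolean function, and any two of the three determine it. On every 4 x 4 plane
   at least one colour is additive, so a plane is labelled by its additive colour, or by [None]
   if all three are; how the labels of the planes of a 4 x 4 x 4 subcube fit together is settled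
   by a finite search. If no colour is additive on all planes, these local rules produce a colour
   and a proper set [I] of at least two directions such that the colour is additive on the planes
   across [I] while its non-additive planes connect [I]. The level sets of such a colour on the
   [I]-subcubes are connected, whence the quasigroup is a composition whose inner operation has
   the arguments in [I].
   Hence every quasigroup is semilinear, i.e. has an additive colour, or reducible. Up to
   collisions there are [3 ^ (n + 1) * 2 ^ (2 ^ n + 1)] semilinear ones, and the recursion
   [Q |I| * Q (n - |I| + 1)] makes the number of reducible ones [O (2 ^ 2 ^ n)]. *)

Require Import Defs.
From mathcomp Require Import all_boot boolp zify.

Set Implicit Arguments.
Unset Strict Implicit.
Unset Printing Implicit Defensive.

(** * Colours and Latin squares *)

(** Over the field with two elements the alphabet is a plane, the colours are its three nonzero
    linear forms, and passing to the partner in a pair is a translation that flips the other two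
    forms. So a step along a level set of a colour swaps partners whatever the remaining arguments
    are, and a second colour changes equally in every context; this is why connected level sets give
    a composition. The obstacle is the passage from local to global, since labels may vary along a
    subcube. It is met by extremal choices and by a lemma forcing two families of points with
    conflicting colours to meet. In the count, an additive colour leaves one free bit for each of
    $2^n$ classes of words, whereas a composition has exponent about $2^k + 2^{n-k+1}$, by convexity
    at most $2^{n-1} + 4$; hence crude bounds suffice in the recursion. *)

Notation o0 := (@Ordinal 4 0 isT).
Notation o1 := (@Ordinal 4 1 isT).
Notation o2 := (@Ordinal 4 2 isT).
Notation o3 := (@Ordinal 4 3 isT).
Notation c0 := (@Ordinal 3 0 isT).
Notation c1 := (@Ordinal 3 1 isT).
Notation c2 := (@Ordinal 3 2 isT).

Lemma ord4_ind (P : 'I_4 -> Prop) : P o0 -> P o1 -> P o2 -> P o3 -> forall a, P a.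
Proof.
move=> P0 P1 P2 P3 [[|[|[|[|//]]]] lt_a];
  [move: P0|move: P1|move: P2|move: P3]; by congr (P _); apply: val_inj.
Qed.

Lemma ord4_last (p q r s t : 'I_4) : q != p -> r != p -> r != q -> s != p -> s != q ->
  s != r -> t != p -> t != q -> t != r -> t = s.
Proof.
by elim/ord4_ind: p; elim/ord4_ind: q => //; elim/ord4_ind: r => //;
  elim/ord4_ind: s => //; elim/ord4_ind: t.
Qed.

Lemma ord3_ind (P : 'I_3 -> Prop) : P c0 -> P c1 -> P c2 -> forall c, P c.
Proof.
move=> P0 P1 P2 [[|[|[|//]]] lt_c];
  [move: P0|move: P1|move: P2]; by congr (P _); apply: val_inj.
Qed.

(* The three colours are the three partitions of the alphabet into pairs;
   [pr c] tells the two pairs of the colour [c] apart. *)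
Definition pr (c : 'I_3) (a : 'I_4) : bool :=
  match nat_of_ord c with
  | 0 => odd a
  | 1 => 1 < a
  | _ => odd a (+) (1 < a)
  end.

(** The partner of [a] in its pair of the colour [c], a translation of the Klein four-group. *)
Definition swp (c : 'I_3) (a : 'I_4) : 'I_4 :=
  match nat_of_ord c, nat_of_ord a with
  | 0, 0 => o2 | 0, 1 => o3 | 0, 2 => o0 | 0, _ => o1
  | 1, 0 => o1 | 1, 1 => o0 | 1, 2 => o3 | 1, _ => o2
  | _, 0 => o3 | _, 1 => o2 | _, 2 => o1 | _, _ => o0
  end.

Lemma pr_o0 c : pr c o0 = false.
Proof. by elim/ord3_ind: c. Qed.

Lemma pr_inj c d a b : c != d -> pr c a = pr c b -> pr d a = pr d b -> a = b.
Proof.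
by elim/ord3_ind: c; elim/ord3_ind: d; elim/ord4_ind: a; elim/ord4_ind: b.
Qed.

Lemma pr_swp c d a : pr d (swp c a) = pr d a (+) (d != c).
Proof. by elim/ord3_ind: c; elim/ord3_ind: d; elim/ord4_ind: a. Qed.

Lemma pr_swp_same c a : pr c (swp c a) = pr c a.
Proof. by rewrite pr_swp eqxx addbF. Qed.

Lemma swp_neq c a : swp c a != a.
Proof. by elim/ord3_ind: c; elim/ord4_ind: a. Qed.

Lemma pr_eq c a b : pr c a = pr c b -> b = a \/ b = swp c a.
Proof.
by elim/ord3_ind: c; elim/ord4_ind: a; elim/ord4_ind: b => //; by [left|right].
Qed.

Lemma pr_eq_neq c a b : pr c a = pr c b -> b != a -> b = swp c a.
Proof. by case/pr_eq => [->|//]; rewrite eqxx. Qed.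

Lemma pr_same c d : (forall a, pr c a = pr d a) -> c = d.
Proof.
move=> h; move: (h o1) (h o2); by elim/ord3_ind: c {h}; elim/ord3_ind: d.
Qed.

Lemma other_colour (c : 'I_3) : exists d, d != c.
Proof. by elim/ord3_ind: c; [exists c1|exists c0|exists c0]. Qed.

(** Comparison with row and column [o0] suffices for additivity; explicit lists keep the test cheap
    inside the searches. *)
Definition badd (s : 'I_4 -> 'I_4 -> bool) : bool :=
  all (fun a => all (fun b => s a b (+) s o0 b == s a o0 (+) s o0 o0)
                    [:: o1; o2; o3]) [:: o1; o2; o3].

Lemma baddP s :
  reflect (forall a b c d, s a b (+) s c b = s a d (+) s c d) (badd s).
Proof.
apply: (iffP idP) => [h|h]; last by apply/allP => a _; apply/allP => b _; rewrite (h a b o0 o0).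
have h0 a b : s a b (+) s o0 b = s a o0 (+) s o0 o0.
  case: (a =P o0) => [->|/eqP na]; first by rewrite !addbb.
  case: (b =P o0) => [->//|/eqP nb].
  have in3 (u : 'I_4) : u != o0 -> u \in [:: o1; o2; o3] by elim/ord4_ind: u.
  by move/allP: h => /(_ _ (in3 _ na)) /allP /(_ _ (in3 _ nb)) /eqP.
have e a b : s a b = s a o0 (+) s o0 b (+) s o0 o0.
  by rewrite -addbA [s o0 b (+) _]addbC addbA -(h0 a b) -addbA addbb addbF.
move=> a b c d; rewrite (e a b) (e c b) (e a d) (e c d).
by case: (s a o0); case: (s c o0); case: (s o0 b); case: (s o0 d); case: (s o0 o0).
Qed.

(* [None] means that all three colours are additive on the Latin square,
   i.e. that it is isotopic to the Klein four-group. *)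
Definition lab (s : 'I_4 -> 'I_4 -> 'I_4) : option 'I_3 :=
  let ad c := badd (fun a b => pr c (s a b)) in
  if ad c0 then if ad c1 then None else Some c0
  else if ad c1 then Some c1 else Some c2.

Definition lok (c : 'I_3) (t : option 'I_3) : bool :=
  if t is Some d then d == c else true.

Definition latin2 (s : 'I_4 -> 'I_4 -> 'I_4) : Prop :=
  (forall b, injective (fun a => s a b)) /\ (forall a, injective (s a)).

(** * Backtracking search and the Latin squares of order 4 *)

Section Search.
Variables (X : eqType) (cands : seq X) (ok : seq X -> X -> bool).
Variable chk : seq X -> bool.

(** Extensions rejected by [ok] are pruned and [chk] is demanded at the surviving leaves, so one
    evaluation certifies [chk] for all admissible lists. *)
Fixpoint search k (acc : seq X) : bool :=
  if k is k'.+1 then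
    all (fun r => if ok acc r then search k' (rcons acc r) else true) cands
  else chk acc.

Lemma searchP k acc rest : search k acc -> size rest = k ->
  {subset rest <= cands} ->
  (forall p r q, rest = p ++ r :: q -> ok (acc ++ p) r) ->
  chk (acc ++ rest).
Proof.
elim: k acc rest => [|k IHk] acc [|r rest] //=; first by rewrite cats0.
move=> /allP hs [hsz] hc hok.
have rc : r \in cands by apply: hc; rewrite mem_head.
have := hs r rc; rewrite -[acc]cats0 (hok [::] r rest) // cats0 => hs'.
rewrite -cat_rcons; apply: IHk => //.
  by move=> u hu; apply: hc; rewrite inE hu orbT.
by move=> p u q e; rewrite cat_rcons; apply: (hok (r :: p) u q); rewrite e.
Qed.
End Search.

Definition A4 : seq 'I_4 := [:: o0; o1; o2; o3].
Definition C3 : seq 'I_3 := [:: c0; c1; c2].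

Lemma mem_A4 a : a \in A4. Proof. by elim/ord4_ind: a. Qed.
Lemma mem_C3 c : c \in C3. Proof. by elim/ord3_ind: c. Qed.

Definition perms4 : seq (seq 'I_4) :=
  filter uniq
    (flatten [seq [seq [:: a.1; a.2; b.1; b.2] | b <- allpairs pair A4 A4]
             | a <- allpairs pair A4 A4]).

Definition row (s : 'I_4 -> 'I_4) : seq 'I_4 := map s A4.

Lemma row_perms4 s : injective s -> row s \in perms4.
Proof.
move=> s_inj; rewrite mem_filter map_inj_uniq //; apply/andP; split=> //.
apply/flatten_mapP; exists (s o0, s o1).
  by apply/allpairsP; exists (s o0, s o1); rewrite !mem_A4.
apply/mapP; exists (s o2, s o3) => //.
by apply/allpairsP; exists (s o2, s o3); rewrite !mem_A4.
Qed.

Lemma nth_row s (a : 'I_4) : nth o0 (row s) a = s a.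
Proof. by elim/ord4_ind: a. Qed.

Definition derange (r t : seq 'I_4) : bool := all (fun a => nth o0 r a != nth o0 t a) (iota 0 4).

Lemma derange_row s t : (forall a, s a != t a) -> derange (row s) (row t).
Proof. by move=> h; rewrite /derange /= !h. Qed.

Definition sq_of (rows : seq (seq 'I_4)) (a b : 'I_4) : 'I_4 := nth o0 (nth [::] rows b) a.

Definition sq_chk rows :=
  has (fun c => badd (fun a b => pr c (sq_of rows a b))) C3.

(** Up to isotopy the Latin squares of order 4 are the two groups of order 4; the cyclic one has
    exactly one additive colour. *)
Lemma sq_search : search perms4 (fun acc r => all (derange r) acc) sq_chk 4 [::].
Proof. by vm_compute. Qed.

Lemma latin2_additive s : latin2 s -> exists c, badd (fun a b => pr c (s a b)).
Proof.
move=> [s1 s2]; pose rows := [seq row (fun a => s a b) | b <- A4].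
have es : sq_of rows = s.
  by apply/funext => a; apply/funext => b; elim/ord4_ind: b; rewrite /sq_of /= nth_row.
suff /hasP[c _ hc] : sq_chk ([::] ++ rows) by exists c; rewrite -es.
apply: (searchP sq_search) => //.
  by move=> r /mapP[b _ ->]; apply: row_perms4.
move=> p r q e; rewrite cat0s.
have u : uniq (p ++ r :: q).
  rewrite -e map_inj_uniq // => b b' /(congr1 (fun t => nth o0 t o0)).
  by rewrite !nth_row => /s2.
apply/allP => t tp.
have /mapP[b _ rb] : r \in rows by rewrite e mem_cat mem_head orbT.
have /mapP[b' _ tb] : t \in rows by rewrite e mem_cat tp.
rewrite rb tb; apply: derange_row => a; apply/eqP => /s2 ebb.
move: u; rewrite cat_uniq => /and3P[_ /hasPn /(_ r) + _].
by rewrite mem_head => /(_ isT); rewrite /= rb ebb -tb tp.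
Qed.

Lemma badd_xor c d e s : c != d -> c != e -> d != e ->
  badd (fun a b => pr c (s a b)) -> badd (fun a b => pr d (s a b)) ->
  badd (fun a b => pr e (s a b)).
Proof.
move=> cd ce de /baddP hc /baddP hd; apply/baddP => a b a' b'.
have px v : pr e v = pr c v (+) pr d v.
  move: cd ce de.
  by elim/ord3_ind: c {hc}; elim/ord3_ind: d {hd}; elim/ord3_ind: e; elim/ord4_ind: v.
by rewrite !px addbACA (hc a b a' b') (hd a b a' b') addbACA.
Qed.

(** The third colour is the sum of the other two, so two additive colours force the third; since at
    least one is additive, even the default branch [Some c2] of [lab] is faithful. *)
Lemma lab_badd s c : latin2 s -> badd (fun a b => pr c (s a b)) = lok c (lab s).
Proof.
move=> /latin2_additive[d]; rewrite /lab.
have x01 := @badd_xor c0 c1 c2 s isT isT isT.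
have x02 := @badd_xor c0 c2 c1 s isT isT isT.
have x12 := @badd_xor c1 c2 c0 s isT isT isT.
move: x01 x02 x12.
case h0: (badd _); case h1: (badd _) => //=; case h2: (badd _) => /=;
  do 3?[by move/(_ isT isT)|move=> _]; elim/ord3_ind: c; elim/ord3_ind: d;
  by rewrite ?h0 ?h1 ?h2.
Qed.

Lemma lab_eq t u : (forall c, lok c t = lok c u) -> t = u.
Proof.
move=> h; move: (h c0) (h c1) (h c2).
by case: t {h} => [a|]; case: u => [b|] //=; try elim/ord3_ind: a; try elim/ord3_ind: b.
Qed.

(** * Latin cubes *)

Definition latin3 (q : 'I_4 -> 'I_4 -> 'I_4 -> 'I_4) : Prop :=
  [/\ forall b c, injective (fun a => q a b c),
      forall a c, injective (fun b => q a b c) &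
      forall a b, injective (q a b)].

Definition lab12 (q : 'I_4 -> 'I_4 -> 'I_4 -> 'I_4) c := lab (fun a b => q a b c).
Definition lab13 (q : 'I_4 -> 'I_4 -> 'I_4 -> 'I_4) b := lab (fun a c => q a b c).
Definition lab23 (q : 'I_4 -> 'I_4 -> 'I_4 -> 'I_4) a := lab (fun b c => q a b c).

Definition semi_on d (X Y Z : 'I_4 -> option 'I_3) : Prop :=
  forall u, [/\ lok d (X u), lok d (Y u) & lok d (Z u)].

(** [X] belongs to the parallel planes spanned by the inner arguments of a composition, [Y] and [Z]
    to the planes containing the outer direction. *)
Definition strict_on b (X Y Z : 'I_4 -> option 'I_3) : Prop :=
  (forall u, [/\ ~~ lok b (X u), Y u = Some b & Z u = Some b]) /\ (exists u v, X u != X v).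

Definition cube_rule (X Y Z : 'I_4 -> option 'I_3) : Prop :=
  exists b, [\/ semi_on b X Y Z, strict_on b X Y Z, strict_on b Y X Z | strict_on b Z X Y].

Definition semi_onb d (X Y Z : 'I_4 -> option 'I_3) :=
  all (fun u => [&& lok d (X u), lok d (Y u) & lok d (Z u)]) A4.

Definition strict_onb b (X Y Z : 'I_4 -> option 'I_3) :=
  all (fun u => [&& ~~ lok b (X u), Y u == Some b & Z u == Some b]) A4 &&
  has (fun u => has (fun v => X u != X v) A4) A4.

Definition cube_ruleb X Y Z :=
  has (fun b => [|| semi_onb b X Y Z, strict_onb b X Y Z, strict_onb b Y X Z
                  | strict_onb b Z X Y]) C3.

Lemma cube_rulebP X Y Z : cube_ruleb X Y Z -> cube_rule X Y Z.
Proof.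
have st b U V W : strict_onb b U V W -> strict_on b U V W.
  case/andP => /allP h /hasP[u _ /hasP[v _ uv]]; split; last by exists u, v.
  by move=> w; have /and3P[? /eqP ? /eqP ?] := h w (mem_A4 w); split.
case/hasP => b _ h; exists b; case/or4P: h => h.
- by apply: Or41 => u; have /and3P := allP h u (mem_A4 u).
- by apply: Or42; apply: st.
- by apply: Or43; apply: st.
- by apply: Or44; apply: st.
Qed.

(** Tabulation makes the search compute each label only once. *)
Definition tab (X : 'I_4 -> option 'I_3) : 'I_4 -> option 'I_3 :=
  let s := map X A4 in fun u => nth None s u.

Lemma tabE X : tab X = X.
Proof. by apply/funext => u; elim/ord4_ind: u. Qed.

Definition cube_chk q := cube_ruleb (tab (lab12 q)) (tab (lab13 q)) (tab (lab23 q)).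

(* Row [4 * b + c] lists the values [q a b c] for [a] in [A4]. *)
Definition cube_of (rows : seq (seq 'I_4)) (a b c : 'I_4) : 'I_4 :=
  nth o0 (nth [::] rows (4 * b + c)) a.

Definition cube_ok (acc : seq (seq 'I_4)) (r : seq 'I_4) :=
  let k := size acc in
  ((k < 4) ==> (val (head o0 r) == k)) && ((k %% 4 == 0) ==> (val (head o0 r) == k %/ 4)) &&
  all (fun p => ((p %/ 4 == k %/ 4) || (p %% 4 == k %% 4)) ==> derange r (nth [::] acc p))
      (iota 0 k).

(** The three axes through the origin are the identity: [cube_ok] imposes this on two of them and
    the initial row [A4] on the third, which leaves 15 rows. *)
Lemma cube_search :
  search perms4 cube_ok (fun rows => cube_chk (cube_of rows)) 15 [:: A4].
Proof. by vm_compute. Qed.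

Lemma cube_rule_normalised q : latin3 q -> (forall a, q a o0 o0 = a) ->
  (forall b, q o0 b o0 = b) -> (forall c, q o0 o0 c = c) ->
  cube_rule (lab12 q) (lab13 q) (lab23 q).
Proof.
move=> [q1 q2 q3] qa qb qc.
pose rw b c := row (fun a => q a b c).
pose rows := [seq rw b c | b <- A4, c <- A4].
have nthr (b c : 'I_4) : nth [::] rows (4 * b + c) = rw b c.
  by elim/ord4_ind: b; elim/ord4_ind: c.
have eq_rows : cube_of rows = q.
  apply/funext => a; apply/funext => b; apply/funext => c.
  by rewrite /cube_of nthr nth_row.
have rowsE : rows = [:: A4] ++ behead rows.
  by rewrite /rows /= /rw /row /= !qa.
suff: cube_chk q by rewrite /cube_chk !tabE => /cube_rulebP.
rewrite -eq_rows rowsE; apply: (searchP cube_search) => //.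
  by move=> r /mem_behead /allpairsP[[b c] [_ _ ->]]; apply: row_perms4.
move=> p r t e; have {}e : rows = ([:: A4] ++ p) ++ r :: t by rewrite rowsE e catA.
set s := _ ++ p in e *; set k := size s.
have k16 : k < 16.
  have -> : 16 = size rows by [].
  by rewrite e size_cat /= addnS ltnS leq_addr.
have decomp m : m < 16 -> exists b c : 'I_4, m = 4 * b + c /\ nth [::] rows m = rw b c.
  move=> m16; have mb : m %/ 4 < 4 by rewrite ltn_divLR.
  have mc : m %% 4 < 4 by rewrite ltn_mod.
  exists (Ordinal mb), (Ordinal mc); have em : m = 4 * (m %/ 4) + m %% 4.
    by rewrite mulnC -divn_eq.
  by split=> //; rewrite {1}em (nthr (Ordinal mb) (Ordinal mc)).
have dm (b c : 'I_4) : ((4 * b + c) %/ 4 = b) * ((4 * b + c) %% 4 = c).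
  by elim/ord4_ind: b; elim/ord4_ind: c.
have [b [c [ek er]]] := decomp _ k16.
have {}er : r = rw b c by rewrite -er e nth_cat ltnn subnn.
rewrite /cube_ok -/k er; apply/andP; split.
  apply/andP; split; apply/implyP.
    rewrite ek; case: (b =P o0) => [-> _|/eqP b0]; first by rewrite /rw /= qc add0n.
    by move: b0; elim/ord4_ind: b {er ek}.
  rewrite ek !dm => c0; have -> : c = o0 by apply: val_inj; apply/eqP.
  by rewrite /rw /= qb.
apply/allP => m; rewrite mem_iota => /andP[_ mk]; rewrite add0n in mk.
have [b' [c' [em]]] := decomp _ (ltn_trans mk k16).
rewrite {1}e nth_cat mk => ->.
move: mk; rewrite ek em !dm => mk; apply/implyP => /orP[]/eqP /val_inj h.
  rewrite h; apply: derange_row => a; apply/eqP => /q3 ec.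
  by move: mk; rewrite h ec ltnn.
rewrite h; apply: derange_row => a; apply/eqP => /q2 ec.
by move: mk; rewrite h ec ltnn.
Qed.

Lemma lab_reindex s (sg tu : 'I_4 -> 'I_4) : latin2 s -> injective sg -> injective tu ->
  lab (fun a b => s (sg a) (tu b)) = lab s.
Proof.
move=> [s1 s2] sgI tuI; apply: lab_eq => c; rewrite -!lab_badd //; last first.
  by split=> u v w => [/s1 /sgI|/s2 /tuI].
apply/baddP/baddP => h a b a' b'; last exact: h.
have := h (invF sgI a) (invF tuI b) (invF sgI a') (invF tuI b').
by rewrite !f_invF.
Qed.

Definition perm_colour_chk (r : seq 'I_4) :=
  all (fun c => has (fun d =>
    all (fun v : 'I_4 => pr d (nth o0 r v) (+) pr d (nth o0 r 0) == pr c v) A4) C3) C3.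

Lemma perm_colour_search : all perm_colour_chk perms4.
Proof. by vm_compute. Qed.

(** The action of $S_4$ on the three pairings of four points; [e] tells whether the two pairs are
    exchanged. *)
Lemma perm_colour (p : 'I_4 -> 'I_4) : injective p ->
  exists t : 'I_3 -> 'I_3, injective t /\
    forall c, exists e, forall v, pr (t c) (p v) = pr c v (+) e.
Proof.
move=> /row_perms4 pI; have /allP h := allP perm_colour_search _ pI.
have {h} h c : exists d, forall v, pr d (p v) (+) pr d (p o0) = pr c v.
  have /hasP[d _ /allP hd] := h c (mem_C3 c).
  exists d => v; have := hd v (mem_A4 v).
  by rewrite (nth_row p v) (nth_row p o0) => /eqP.
have [t ht] := choice h; exists t; split.
  by move=> c d e; apply: pr_same => v; rewrite -(ht c) -(ht d) e.
by move=> c; exists (pr (t c) (p o0)) => v; rewrite -(ht c v) -addbA addbb addbF.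
Qed.

Lemma lab_output p t s : latin2 s -> injective p -> injective t ->
    (forall c, exists e, forall v, pr (t c) (p v) = pr c v (+) e) ->
  lab (fun a b => p (s a b)) = omap t (lab s).
Proof.
move=> ls pI tI ht; apply: lab_eq => c; rewrite -(f_invF tI c); set d := invF tI c.
have [e he] := ht d.
rewrite -lab_badd; last by case: ls => s1 s2; split=> u v w /pI; [apply: s1|apply: s2].
have -> : lok (t d) (omap t (lab s)) = lok d (lab s).
  by case: (lab s) => //= u; rewrite (inj_eq tI).
rewrite -lab_badd //; apply/baddP/baddP => h a b a' b'.
  by have := h a b a' b'; rewrite !he !(addbACA _ e) addbb !addbF.
by rewrite !he !(addbACA _ e) addbb !addbF.
Qed.

Lemma cube_rule_transfer X Y Z X' Y' Z' (t : 'I_3 -> 'I_3) (f g h : 'I_4 -> 'I_4) :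
    injective t -> injective f -> injective g -> injective h ->
    (forall u, X' u = omap t (X (f u))) -> (forall u, Y' u = omap t (Y (g u))) ->
    (forall u, Z' u = omap t (Z (h u))) ->
  cube_rule X Y Z -> cube_rule X' Y' Z'.
Proof.
move=> tI fI gI hI eX eY eZ [b hb]; exists (t b).
have lt w : lok (t b) (omap t w) = lok b w by case: w => //= u; rewrite (inj_eq tI).
have ti : injective (omap t) by move=> [u|] [v|] //= [/tI ->].
have st U V W U' V' W' (k k' k'' : 'I_4 -> 'I_4) : injective k ->
    (forall u, U' u = omap t (U (k u))) -> (forall u, V' u = omap t (V (k' u))) ->
    (forall u, W' u = omap t (W (k'' u))) -> strict_on b U V W -> strict_on (t b) U' V' W'.
  move=> kI eU eV eW [hu [u [v uv]]]; split.
    move=> w; rewrite eU eV eW lt; have [? _ _] := hu (k w).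
    by have [_ -> _] := hu (k' w); have [_ _ ->] := hu (k'' w).
  by exists (invF kI u), (invF kI v); rewrite !eU !f_invF (inj_eq ti).
case: hb => hb.
- apply: Or41 => u; rewrite eX eY eZ !lt.
  by have [? _ _] := hb (f u); have [_ ? _] := hb (g u); have [_ _ ?] := hb (h u).
- by apply: Or42; apply: (st _ _ _ _ _ _ f g h) hb.
- by apply: Or43; apply: (st _ _ _ _ _ _ g f h) hb.
- by apply: Or44; apply: (st _ _ _ _ _ _ h f g) hb.
Qed.

(** Isotopy reduces to the normalised case: the output is pulled back along the first axis [p],
    while [sg] and [tu] straighten the other two. Labels are only permuted among parallel planes and
    renamed. *)
Lemma latin3_rule q : latin3 q -> cube_rule (lab12 q) (lab13 q) (lab23 q).
Proof.
move=> lq; have [q1 q2 q3] := lq.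
pose p a := q a o0 o0; have pI : injective p := q1 o0 o0.
have ipI : injective (invF pI) := can_inj (f_invF pI).
pose sg := invF (inj_comp ipI (q2 o0 o0)); pose tu := invF (inj_comp ipI (q3 o0 o0)).
have sgI : injective sg := can_inj (f_invF _).
have tuI : injective tu := can_inj (f_invF _).
have qsg b : q o0 (sg b) o0 = p b.
  by apply: (ipI); rewrite invF_f; apply: (f_invF (inj_comp ipI (q2 o0 o0))).
have qtu c : q o0 o0 (tu c) = p c.
  by apply: (ipI); rewrite invF_f; apply: (f_invF (inj_comp ipI (q3 o0 o0))).
have sg0 : sg o0 = o0 by apply: (q2 o0 o0); rewrite qsg.
have tu0 : tu o0 = o0 by apply: (q3 o0 o0); rewrite qtu.
pose q' a b c := invF pI (q a (sg b) (tu c)).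
have lq' : latin3 q'.
  by split=> u v x y /ipI; [move/q1|move/q2/sgI|move/q3/tuI].
have [t [tI ht]] := perm_colour ipI.
have ru : cube_rule (lab12 q') (lab13 q') (lab23 q').
  apply: cube_rule_normalised => // [a|b|c]; rewrite /q'.
  - by rewrite sg0 tu0 (invF_f pI).
  - by rewrite tu0 qsg invF_f.
  - by rewrite sg0 qtu invF_f.
pose ti := invF tI; have tiI : injective ti := can_inj (f_invF tI).
have tK w : omap ti (omap t w) = w by case: w => //= c; rewrite /ti invF_f.
have isgI : injective (invF sgI) := can_inj (f_invF sgI).
have ituI : injective (invF tuI) := can_inj (f_invF tuI).
apply: (cube_rule_transfer tiI ituI isgI (@inj_id _) _ _ _ ru) => u.
- rewrite /lab12 (lab_output _ ipI tI ht) ?tK ?f_invF; last first.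
    by split=> v x y; [move/q1|move/q2/sgI].
  by apply/esym/(lab_reindex (s := fun a b => q a b u) (sg := id) (tu := sg)).
- rewrite /lab13 (lab_output _ ipI tI ht) ?tK ?f_invF; last first.
    by split=> v x y; [move/q1|move/q3/tuI].
  by apply/esym/(lab_reindex (s := fun a c => q a u c) (sg := id) (tu := tu)).
- rewrite /lab23 (lab_output _ ipI tI ht) ?tK; last first.
    by split=> v x y; [move/q2/sgI|move/q3/tuI].
  by apply/esym/(lab_reindex (s := fun b c => q u b c) (sg := sg) (tu := tu)).
Qed.

(** * Words, subcubes and balanced Boolean functions *)

Lemma bool_neq (b c : bool) : c <> b -> c = ~~ b.
Proof. by case: b; case: c. Qed.

Section Words.
Variable T : finType.
Implicit Types (x y z w : {ffun T -> 'I_4}) (i j k : T) (a : 'I_4) (S I J : {set T}).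

Definition upd x i a : {ffun T -> 'I_4} := [ffun j => if j == i then a else x j].

Lemma updE x i a j : upd x i a j = if j == i then a else x j.
Proof. by rewrite ffunE. Qed.

Lemma upd_same x i a : upd x i a i = a.
Proof. by rewrite updE eqxx. Qed.

Lemma upd_other x i a j : j != i -> upd x i a j = x j.
Proof. by rewrite updE => /negPf ->. Qed.

Lemma upd_id x i : upd x i (x i) = x.
Proof. by apply/ffunP => j; rewrite updE; case: eqP => [->|]. Qed.

Lemma upd_fix x i a : x i = a -> upd x i a = x.
Proof. by move<-; apply: upd_id. Qed.

Lemma upd_upd x i a (b : 'I_4) : upd (upd x i a) i b = upd x i b.
Proof. by apply/ffunP => j; rewrite !updE; case: eqP. Qed.

Lemma updC x i j a (b : 'I_4) : i != j -> upd (upd x i a) j b = upd (upd x j b) i a.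
Proof.
move=> ij; apply/ffunP => k; rewrite !updE.
by case: (k =P j) => // ->; rewrite eq_sym (negPf ij).
Qed.

Definition mix S x y : {ffun T -> 'I_4} := [ffun i => if i \in S then y i else x i].

Lemma mixE S x y i : mix S x y i = if i \in S then y i else x i.
Proof. by rewrite ffunE. Qed.

Definition cube S z x := [forall j, (j \notin S) ==> (x j == z j)].

Lemma cubeP S z x : reflect (forall j, j \notin S -> x j = z j) (cube S z x).
Proof.
apply: (iffP forallP) => h j; first by move=> jS; apply/eqP; move/implyP: (h j); apply.
by apply/implyP => /h ->.
Qed.

Lemma cube_refl S z : cube S z z.
Proof. exact/cubeP. Qed.

Lemma cube_sym S z x : cube S z x -> cube S x z.
Proof. by move/cubeP=> h; apply/cubeP => j /h ->. Qed.

Lemma cube_trans S x y z : cube S x y -> cube S y z -> cube S x z.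
Proof. by move=> /cubeP h /cubeP h'; apply/cubeP => j jS; rewrite h' ?h. Qed.

Lemma cube_sub S I z x : S \subset I -> cube S z x -> cube I z x.
Proof.
move=> /subsetP SI /cubeP h; apply/cubeP => j jI; apply: h.
by apply: contra jI => /SI.
Qed.

Lemma cube_upd S z x i a : i \in S -> cube S z x -> cube S z (upd x i a).
Proof.
move=> iS /cubeP h; apply/cubeP => j jS; rewrite upd_other ?h //.
by apply: contraNneq jS => ->.
Qed.

Lemma cube_upd2 S z x i a : cube S z x -> cube S (upd z i a) (upd x i a).
Proof. by move/cubeP=> h; apply/cubeP => j jS; rewrite !updE h. Qed.

Lemma cube_mix S z x y : cube S x (mix S x y).
Proof. by apply/cubeP => j jS; rewrite mixE (negPf jS). Qed.

Lemma mix_cube S x y : cube S x y -> mix S x y = y.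
Proof.
by move/cubeP => h; apply/ffunP => j; rewrite mixE; case: ifPn => // /h ->.
Qed.

(** Walks from [x] to [y], setting one coordinate of [S] at a time to its final value. *)
Lemma cube_ind S x y (P : {ffun T -> 'I_4} -> Prop) : P x ->
  (forall w i, i \in S -> cube S x w -> P w -> P (upd w i (y i))) ->
  cube S x y -> P y.
Proof.
move=> Px Pu xy; rewrite -(mix_cube xy).
pose g := foldr (fun i w => upd w i (y i)) x.
have -> : mix S x y = g (enum S).
  apply/ffunP => j; rewrite mixE -mem_enum; elim: (enum S) => //= i s IHs.
  by rewrite inE updE -IHs; case: (j =P i) => [->|].
have : {subset enum S <= S} by move=> i; rewrite mem_enum.
elim: (enum S) => [//|i s IHs] sS.
have iS : i \in S by apply: sS; rewrite mem_head.
have sS' : {subset s <= S} by move=> u us; apply: sS; rewrite inE us orbT.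
have cs : cube S x (g s).
  elim: (s) sS' => [_|u t IHt h]; first exact: cube_refl.
  by apply: cube_upd; [|apply: IHt => v vt]; apply: h; rewrite inE ?eqxx ?vt ?orbT.
by apply: Pu => //; apply: IHs.
Qed.

(** * Additive planes and connected level sets of balanced functions *)

Definition add (D : {ffun T -> 'I_4} -> bool) i j x :=
  badd (fun a b => D (upd (upd x i a) j b)).

Section Balanced.
Variable D : {ffun T -> 'I_4} -> bool.

Lemma addP i j x : reflect (forall a b c d,
    D (upd (upd x i a) j b) (+) D (upd (upd x i c) j b)
      = D (upd (upd x i a) j d) (+) D (upd (upd x i c) j d)) (add D i j x).
Proof. exact: baddP. Qed.

Lemma addC i j x : i != j -> add D i j x = add D j i x.
Proof.
have s u v y : u != v -> add D u v y -> add D v u y.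
  move=> uv /addP h; apply/addP => a b c d; have := h b a d c; rewrite !(updC _ _ _ uv).
  move: (D _) (D _) (D _) (D _) => p q r t.
  by case: p; case: q; case: r; case: t.
by move=> ij; apply/idP/idP; apply: s; rewrite // eq_sym.
Qed.

Definition balanced := forall x i a, exists a', [/\ a' != a, D (upd x i a') = D (upd x i a) &
  forall b, b != a -> b != a' -> D (upd x i b) = ~~ D (upd x i a)].

(** Connectedness, phrased by cuts, of the graph on [I] whose edges are the pairs of directions
    spanning a non-additive plane somewhere in the subcube. *)
Definition prime I z := forall S, S \subset I -> S != set0 -> S != I ->
  exists i j x, [/\ i \in S, j \in I, j \notin S, cube I z x & ~~ add D i j x].

(** Connectedness of the level set [D = b] under moves along lines, phrased without paths: an
    invariant Boolean function is constant. *)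
Definition conn I z (b : bool) := forall phi : {ffun T -> 'I_4} -> bool,
  (forall x i a, cube I z x -> i \in I -> D x = b -> D (upd x i a) = b ->
     phi (upd x i a) = phi x) ->
  forall x y, cube I z x -> cube I z y -> D x = b -> D y = b -> phi x = phi y.

(** By additivity each step inside [J] changes [D] equally in both layers, so parallel layers agree
    up to one constant. *)
Lemma cross_diff J z j a : j \notin J ->
  (forall i x, i \in J -> cube (j |: J) z x -> add D i j x) ->
  exists e, forall x, cube J z x -> D (upd x j a) = D x (+) e.
Proof.
move=> jJ h; exists (D (upd z j a) (+) D z) => x zx.
move: zx; apply: (cube_ind (P := fun x => D (upd x j a) = D x (+) (D (upd z j a) (+) D z))).
  by rewrite addbC -addbA addbb addbF.
move=> w i iJ zw ew; have ij : i != j by apply: contraNneq jJ => <-.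
have zw' : cube (j |: J) z w by apply: cube_sub zw; rewrite subsetUr.
have /addP/(_ (x i) a (w i) (w j)) := h i w iJ zw'.
rewrite upd_id -(@upd_other w i (x i) j) 1?eq_sym // upd_id upd_other 1?eq_sym //.
rewrite upd_id ew; case: (D _); case: (D _); case: (D _); case: (D _) => //.
all: by case: (D (upd w i (x i))).
Qed.

Lemma prime_shift J z j a e :
  (forall x, cube J z x -> D (upd x j a) = D x (+) e) -> j \notin J ->
  prime J z -> prime J (upd z j a).
Proof.
move=> he jJ pJ S SJ S0 SN; have [i [k [x [iS kJ kS zx nadd]]]] := pJ S SJ S0 SN.
exists i, k, (upd x j a); split=> //; first exact: cube_upd2.
have iJ := subsetP SJ _ iS.
have ji : j != i by apply: contraNneq jJ => ->.
have jk : j != k by apply: contraNneq jJ => ->.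
apply: contra nadd => /addP h; apply/addP => u v u' v'.
have := h u v u' v'; rewrite !(updC _ _ _ ji) !(updC _ _ _ jk) !he;
  do ?[by do ?apply: cube_upd].
by rewrite !(addbACA _ e) addbb !addbF.
Qed.

Lemma prime_cube J z z' : cube J z z' -> prime J z -> prime J z'.
Proof.
move=> zz' pJ S SJ S0 SN; have [i [k [x [iS kJ kS zx nadd]]]] := pJ S SJ S0 SN.
by exists i, k, x; split=> //; apply: cube_trans (cube_sym zz') zx.
Qed.

Lemma prime_set1 i z : prime [set i] z.
Proof.
move=> S Si /set0Pn[j jS] /negP[]; rewrite eqEsubset Si sub1set.
by move: (subsetP Si _ jS); rewrite inE => /eqP <-.
Qed.

Lemma nprime_cut I z : ~ prime I z -> exists S, [/\ S \subset I, S != set0, S != I &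
  forall i j x, i \in S -> j \in I -> j \notin S -> cube I z x -> add D i j x].
Proof.
move=> /existsNP[S h]; exists S.
have /not_implyP[? {}h] := h; have /not_implyP[? {}h] := h; have /not_implyP[? {}h] := h.
split=> // i j x iS jI jS zx; apply: contrapT => /negP nadd.
by apply: h; exists i, j, x.
Qed.

(* Enlarging a prime subcube by one direction either keeps it prime or splits off this direction. *)
Lemma prime_setU1 J z j : prime J z -> j \notin J ->
  prime (j |: J) z \/ (forall i x, i \in J -> cube (j |: J) z x -> add D i j x).
Proof.
move=> pJ jJ; have [|np] := EM (prime (j |: J) z); [by left|right].
have [S [SI S0 SN h]] := nprime_cut np.
have [e0|n0] := eqVneq (S :&: J) set0.
  have Sj : S = [set j].
    apply/eqP; rewrite eqEsubset; apply/andP; split.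
      apply/subsetP => i iS; have := subsetP SI i iS; rewrite !inE => /orP[//|iJ].
      by have := in_set0 i; rewrite -e0 inE iS iJ.
    case/set0Pn: S0 => k kS; have := subsetP SI k kS; rewrite !inE => /orP[/eqP <-|kJ].
      by rewrite sub1set.
    by have := in_set0 k; rewrite -e0 inE kS kJ.
  move=> i x iJ zx; have ij : i != j by apply: contraNneq jJ => <-.
  by rewrite addC //; apply: h; rewrite ?Sj ?inE ?iJ ?orbT ?eqxx.
have [eJ|nJ] := eqVneq (S :&: J) J.
  have JS : J \subset S by rewrite -eJ subsetIl.
  have jS : j \notin S.
    apply: contraNN SN => jS; rewrite eqEsubset SI; apply/subsetP => k.
    by rewrite !inE => /orP[/eqP ->//|/(subsetP JS)].
  by move=> i x iJ zx; apply: h => //; [apply: (subsetP JS)|rewrite setU11].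
have [i [k [x [iS kJ kS zx /negP[]]]]] := pJ _ (subsetIr _ _) n0 nJ.
move: iS kS; rewrite !inE kJ andbT => /andP[iS iJ] kS.
apply: h => //; first by rewrite !inE kJ orbT.
by apply: cube_sub zx; rewrite subsetUr.
Qed.

Hypothesis Dbal : balanced.

Lemma balanced_exists x i (b : bool) : exists a, D (upd x i a) = b.
Proof.
have [a' [na e h]] := Dbal x i o0.
have [<-|/eqP nb] := eqVneq (D (upd x i o0)) b; first by exists o0.
have [c [c0 ca]] : exists c, c != o0 /\ c != a'.
  by elim/ord4_ind: (a') na => // _; [exists o2|exists o1|exists o1].
by exists c; rewrite h //; case: (b) nb; case: (D _).
Qed.

(** A conflict spreads. Base points below a [b]-point of layer [c] with the wrong [phi] all have
    level [~~ b] and are closed under moves in this level; by connectedness they fill it, and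
    balance then makes layer [c] complementary. *)
Lemma layer_dichotomy I J z z' j (b : bool) (phi : {ffun T -> 'I_4} -> bool) :
    J \subset I -> j \in I -> j \notin J -> J != set0 -> cube I z z' ->
    (forall x i a, cube I z x -> i \in I -> D x = b -> D (upd x i a) = b ->
      phi (upd x i a) = phi x) ->
    (forall b' : bool, conn J z' b') ->
  exists v, (forall w, cube J z' w -> D w = b -> phi w = v) /\
    forall c, (forall w, cube J z' w -> D (upd w j c) = ~~ D w) \/
              (forall w, cube J z' w -> D (upd w j c) = b -> phi (upd w j c) = v).
Proof.
move=> JI jI jJ /set0Pn[i0 i0J] zz' hphi cJ.
have inI w : cube J z' w -> cube I z w.
  by move=> h; apply: cube_trans zz' (cube_sub JI h).
have hphiJ w i a : cube J z' w -> i \in J -> D w = b -> D (upd w i a) = b ->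
    phi (upd w i a) = phi w.
  by move=> h iJ; apply: hphi; [apply: inI|apply: (subsetP JI)].
have [a0 ha0] := balanced_exists z' i0 b.
have zw0 : cube J z' (upd z' i0 a0) by apply: cube_upd => //; apply: cube_refl.
exists (phi (upd z' i0 a0)); set v := phi _.
have v0 w : cube J z' w -> D w = b -> phi w = v.
  by move=> zw Dw; apply: (cJ b phi hphiJ).
split=> // c.
pose Y w := (D (upd w j c) == b) && (phi (upd w j c) != v).
have Yb w : cube J z' w -> D w = b -> Y w = false.
  move=> zw Dw; apply/negP => /andP[/eqP Dc /negP[]].
  by rewrite (hphi w) ?v0 //; apply: inI.
(* The lines in both layers pair [w i] with the same value: the partner above still satisfies [Y],
   and [Y] fails at level [b]. *)
have step w i a : cube J z' w -> i \in J -> D w = ~~ b -> D (upd w i a) = ~~ b ->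
    Y w -> Y (upd w i a).
  move=> zw iJ Dw Da Yw; have [->|na] := eqVneq a (w i); first by rewrite upd_id.
  have ij : i != j by apply: contraNneq jJ => <-.
  have [a' [na' ea' _]] := Dbal (upd w j c) i (w i).
  have wi : upd w j c i = w i by rewrite upd_other.
  rewrite -wi upd_id in ea'; move: (Yw) => /andP[/eqP Dc nv].
  have Yw' : Y (upd w i a').
    rewrite /Y updC // ea' Dc eqxx hphi ?ea' //; last exact: (subsetP JI).
    by apply: cube_upd => //; apply: inI.
  have Da' : D (upd w i a') = ~~ b.
    by apply: bool_neq => e; have := Yb _ (cube_upd a' iJ zw) e; rewrite Yw'.
  have [a'' [na'' ea'' h]] := Dbal w i (w i); rewrite upd_id in ea'' h.
  have u d : d != w i -> D (upd w i d) = ~~ b -> d = a''.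
    by move=> nd; apply: contra_eq => /(h _ nd) ->; rewrite Dw; case: (b).
  by rewrite (u a na Da) -(u a' na' Da').
have Yinv w i a : cube J z' w -> i \in J -> D w = ~~ b -> D (upd w i a) = ~~ b ->
    Y (upd w i a) = Y w.
  move=> zw iJ Dw Da; apply/idP/idP; last exact: step.
  move=> Yu; have := step (upd w i a) i (w i); rewrite upd_upd upd_id; apply=> //.
  exact: cube_upd.
have [[w [zw Dw Yw]]|nY] := EM (exists w, [/\ cube J z' w, D w = ~~ b & Y w]).
  left=> u zu.
  have hY u' : cube J z' u' -> D u' = ~~ b -> D (upd u' j c) = b.
    move=> zu' Du'; have : Y u' by rewrite (cJ (~~ b) Y Yinv u' w).
    by case/andP => /eqP.
  have [Du|/eqP Du] := eqVneq (D u) (~~ b); first by rewrite hY // Du negbK.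
  have ij : i0 != j by apply: contraNneq jJ => <-.
  have {}Du : D u = b by rewrite (bool_neq Du) negbK.
  (* The two values [~~ b] on this base line lie below two values [b]; a third [b] above [u] would
     break the balance. *)
  have [a1 Da1] := balanced_exists u i0 (~~ b).
  have n1 : a1 != u i0.
    by apply/eqP => e; move: Da1; rewrite e upd_id Du; case: (b).
  have [a2 [n21 Da2 h2]] := Dbal u i0 a1.
  have n2 : a2 != u i0.
    by apply/eqP => e; move: Da2; rewrite Da1 e upd_id Du; case: (b).
  rewrite Da1 in Da2.
  have e1 := hY _ (cube_upd a1 i0J zu) Da1; have e2 := hY _ (cube_upd a2 i0J zu) Da2.
  have [a3 [n31 Da3 h3]] := Dbal (upd u j c) i0 a1.
  have e32 : a2 = a3.
    apply/eqP/negPn/negP => ne; have := h3 _ n21 ne.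
    by rewrite -!(updC _ _ _ ij) e1 e2; case: (b).
  have := h3 (u i0); rewrite [_ == a1]eq_sym n1 -e32 [_ == a2]eq_sym n2 => /(_ isT isT).
  by rewrite -!(updC _ _ _ ij) upd_id e1 Du.
right=> w zw Dc; apply: contrapT => /eqP nv.
have Yw : Y w by rewrite /Y Dc eqxx.
have [Dw|/eqP Dw] := eqVneq (D w) b; first by rewrite Yb in Yw.
by apply: nY; exists w; split=> //; apply: bool_neq.
Qed.

(* If the graph of non-additive planes is connected then so are both level sets. *)
Lemma prime_conn I z : I != set0 -> prime I z -> forall b, conn I z b.
Proof.
have [m] := ubnP #|I|; elim: m I z => // m IHm I z; rewrite ltnS => Im I0 pI b phi hphi.
case/set0Pn: (I0) => i0 i0I.
have [I1|I1] := leqP #|I| 1.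
  have eI : I = [set i0] by apply/eqP; rewrite eq_sym eqEcard sub1set i0I cards1.
  move=> x y zx zy Dx Dy.
  have -> : y = upd x i0 (y i0).
    apply/ffunP => k; rewrite updE; case: eqP => [->//|/eqP ki].
    by rewrite (cubeP _ _ _ zx) ?(cubeP _ _ _ zy) // eI inE.
  rewrite hphi //; have -> // : upd x i0 (y i0) = y.
  apply/ffunP => k; rewrite updE; case: eqP => [->//|/eqP ki].
  by rewrite (cubeP _ _ _ zx) ?(cubeP _ _ _ zy) // eI inE.
(* Take a largest proper prime part [J]. Either [I] is [J] with one more direction, or every further
   direction splits off from [J] everywhere, against the primality of [I]. *)
pose Pm (J : {set T}) := `[< [/\ J != set0, J \proper I & exists z', cube I z z' /\ prime J z'] >].
have P1 : Pm [set i0].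
  apply/asboolP; split; last by exists z; split; [apply: cube_refl|apply: prime_set1].
    by apply/set0Pn; exists i0; rewrite inE.
  by rewrite properEcard sub1set i0I cards1.
case: (@arg_maxnP _ _ Pm (fun J => #|J|) P1) => J /asboolP[J0 JpI [z' [zz' pJ]]] Jmax.
have JI := proper_sub JpI.
have nI : ~ (forall i j x, i \in J -> j \in I -> j \notin J -> cube I z x -> add D i j x).
  move=> h; have [i [j [x [iJ jI jJ zx]]]] := pI J JI J0 (proper_neq JpI).
  by rewrite h.
have [j jI jJ] : exists2 j, j \in I & j \notin J by case/properP: JpI.
have [eI|neI] := eqVneq I (j |: J); last first.
  case: nI => i k x iJ kI kJ zx.
  have pr w : cube I z w -> prime J w ->
      forall l, l \in I -> l \notin J -> forall u y, u \in J -> cube (l |: J) w y -> add D u l y.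
    move=> zw pw l lI lJ; have [pl|//] := prime_setU1 pw lJ.
    have /Jmax : Pm (l |: J).
      apply/asboolP; split; [by apply/set0Pn; exists l; rewrite setU11| |by exists w].
      rewrite properEneq; apply/andP; split.
        apply/eqP => e; case/negP: neI.
        by move: jI; rewrite -e !inE (negPf jJ) orbF => /eqP ->.
      by rewrite subUset sub1set lI.
    by rewrite /= cardsU1 lJ add1n ltnn.
  suff px : prime J x by apply: (pr x zx px k kI kJ) => //; apply: cube_refl.
  have zx' : cube I z' x by apply: cube_trans (cube_sym zz') zx.
  move: zx'; apply: (cube_ind (P := fun w => prime J w)) => // w l lI zw pw.
  have [lJ|lJ] := boolP (l \in J).
    by apply: prime_cube pw; apply: cube_upd => //; apply: cube_refl.
  have zw' := cube_trans zz' zw.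
  have [e he] := cross_diff (x l) lJ (fun u y => pr w zw' pw l lI lJ u y).
  exact: prime_shift he lJ pw.
have JIlt : #|J| < #|I| by apply: proper_card.
have cJ := IHm J z' (leq_trans JIlt Im) J0 pJ.
have nshift : ~ (forall c, exists e, forall w, cube J z' w -> D (upd w j c) = D w (+) e).
  move=> hs; apply: nI => i k x iJ; rewrite {1}eI !inE => /orP[/eqP ->|->//] _ zx.
  have ij : i != j by apply: contraNneq jJ => <-.
  apply/addP => a b1 a' b2.
  have [e1 h1] := hs b1; have [e2 h2] := hs b2.
  pose y := upd x j (z' j).
  have zy : cube J z' y.
    apply/cubeP => u uJ; rewrite updE; case: eqP => [->//|/eqP uj].
    have uI : u \notin I by rewrite eI !inE negb_or uj.
    by rewrite (cubeP _ _ _ zx) // (cubeP _ _ _ zz').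
  have E u v : upd (upd x i u) j v = upd (upd y i u) j v.
    by rewrite /y -(updC _ _ _ ij) upd_upd.
  rewrite !E !h1 ?h2; do ?[by apply: cube_upd].
  by rewrite !(addbACA _ e1) !(addbACA _ e2) !addbb.
have [v [hv hd]] := layer_dichotomy JI jI jJ J0 zz' hphi cJ.
suff all_v c w : cube J z' w -> D (upd w j c) = b -> phi (upd w j c) = v.
  have E x : cube I z x -> D x = b -> phi x = v.
    move=> zx Dx; have := all_v (x j) (upd x j (z' j)); rewrite upd_upd upd_id; apply=> //.
    apply/cubeP => u uJ; rewrite updE; case: eqP => [->//|/eqP uj].
    have uI : u \notin I by rewrite eI !inE negb_or uj.
    by rewrite (cubeP _ _ _ zx) // (cubeP _ _ _ zz').
  by move=> x y zx zy Dx Dy; rewrite !E.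
(* If layer [c] is complementary to the base layer, the dichotomy is applied from layer [c] as well.
   A third layer [c'] is complementary to neither and so ties [v] to [v']. *)
case: (hd c) => [hc|]; last exact.
have shc u : cube J z' u -> D (upd u j c) = D u (+) true by move=> /hc ->; rewrite addbT.
have cJ' := IHm J (upd z' j c) (leq_trans JIlt Im) J0 (prime_shift shc jJ pJ).
have [v' [hv' hd']] := layer_dichotomy JI jI jJ J0 (cube_upd c jI zz') hphi cJ'.
have cc : c != z' j.
  by apply/eqP => e; have := hc z' (cube_refl _ _); rewrite e upd_id; case: (D _).
have wj u : cube J z' u -> u j = z' j by move/cubeP; apply.
have [c' [e' [n1 n2 n3]]] : exists c' e', [/\ c' != z' j, c' != c & [/\ e' != z' j, e' != c & c' != e']].
  move: cc; elim/ord4_ind: (z' j); elim/ord4_ind: (c) => // _;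
  by [exists o2, o3|exists o1, o3|exists o1, o2|exists o0, o3|exists o0, o2|exists o0, o1].
case: n3 => n3 n4 n5.
(* On every line in direction [j] the partner of [z' j] is [c'] or [e'], never [c]; so if layer [c']
   were a shift of the base layer, all layers would be. *)
have De u : cube J z' u -> D (upd u j e') = ~~ D (upd u j c').
  move=> zu; have [a [na ea ha]] := Dbal u j (z' j).
  have Du : upd u j (z' j) = u by rewrite -(wj u zu) upd_id.
  rewrite Du in ea ha.
  have ac : a != c by apply: contra_eqN ea => /eqP ->; rewrite hc //; case: (D u).
  have : a = c' \/ a = e'.
    have all4 (p q r s t : 'I_4) : p != q -> r != p -> r != q -> s != p -> s != q -> r != s ->
        t != p -> t != q -> t = r \/ t = s.
      elim/ord4_ind: p; elim/ord4_ind: q => //; elim/ord4_ind: r => //;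
      elim/ord4_ind: s => //; elim/ord4_ind: t => //; by [left|right].
    by apply: (all4 (z' j) c) => //; rewrite eq_sym.
  case=> ea'; subst a; rewrite ea; [rewrite (ha e')|rewrite (ha c')] => //.
    by rewrite eq_sym.
  by rewrite negbK.
have nsh : ~ exists e, forall w, cube J z' w -> D (upd w j c') = D w (+) e.
  case=> e he; apply: nshift => d.
  have [-> |d1] := eqVneq d (z' j).
    by exists false => u zu; rewrite -(wj u zu) upd_id addbF.
  have [-> |d2] := eqVneq d c; first by exists true.
  have [-> |d3] := eqVneq d c'; first by exists e.
  have -> : d = e'.
    by apply: (@ord4_last (z' j) c c'); rewrite // eq_sym.
  by exists (~~ e) => u zu; rewrite De // he // addbN.
have hB u : cube J z' u -> D (upd u j c') = b -> phi (upd u j c') = v.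
  case: (hd c') => [hn|]; last exact.
  by case: nsh; exists true => y zy; rewrite hn // addbT.
have up u : cube J z' u -> cube J (upd z' j c) (upd u j c) by apply: cube_upd2.
have hB' u : cube J z' u -> D (upd u j c') = b -> phi (upd u j c') = v'.
  move=> zu Du; case: (hd' c') => [hn|/(_ (upd u j c))]; last first.
    by rewrite upd_upd; apply=> //; apply: up.
  case: nsh; exists false => y zy; have := hn _ (up y zy).
  by rewrite upd_upd hc // negbK addbF.
move=> zw Dw; rewrite hv' ?up //.
case/set0Pn: (J0) => i1 i1J.
have i1j : i1 != j by apply: contraNneq jJ => <-.
have [a Da] := balanced_exists (upd z' j c') i1 b.
rewrite -(updC _ _ _ i1j) in Da.
have zi : cube J z' (upd z' i1 a) by apply: cube_upd => //; apply: cube_refl.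
by rewrite -(hB _ zi Da) (hB' _ zi Da).
Qed.
End Balanced.
End Words.

(** * Colours of the planes of a quasigroup *)

Lemma ord4_compl (a b : 'I_4) : a != b -> exists p1 p2 : 'I_4,
  [/\ p1 != p2, p1 != a, p1 != b & p2 != a /\ p2 != b].
Proof.
by elim/ord4_ind: a; elim/ord4_ind: b => // _;
  [exists o2, o3|exists o1, o3|exists o1, o2|exists o2, o3|exists o0, o3|exists o0, o2
  |exists o1, o3|exists o0, o3|exists o0, o1|exists o1, o2|exists o0, o2|exists o0, o1].
Qed.

Definition quasi (T : finType) (f : {ffun T -> 'I_4} -> 'I_4) : Prop :=
  forall x i, injective (fun a => f (upd x i a)).

Section Quasigroup.
Variables (T : finType) (f : {ffun T -> 'I_4} -> 'I_4).
Hypothesis fq : quasi f.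
Implicit Types (x y z w : {ffun T -> 'I_4}) (i j k l : T) (a b : 'I_4) (c d : 'I_3)
  (S I J : {set T}).

Definition D c : {ffun T -> 'I_4} -> bool := fun x => pr c (f x).

Lemma D_balanced c : balanced (D c).
Proof.
move=> x i a; pose g a := f (upd x i a); have gI : injective g := @fq x i.
exists (invF gI (swp c (g a))).
have ga : g (invF gI (swp c (g a))) = swp c (g a) by apply: f_invF.
split; first by apply: contraNneq (swp_neq c (g a)) => e; rewrite -ga e.
  by rewrite /D -/(g _) ga pr_swp_same.
move=> u ua ua'; apply: bool_neq => e.
have [/gI e'|e'] := pr_eq (esym e); first by rewrite e' eqxx in ua.
by case/eqP: ua'; apply: (gI); rewrite ga -e'.
Qed.

Definition lb i j x := lab (fun a b => f (upd (upd x i a) j b)).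

Lemma plane_latin i j x : i != j -> latin2 (fun a b => f (upd (upd x i a) j b)).
Proof.
by move=> ij; split=> [b u v|a u v /fq //]; rewrite !(updC _ _ _ ij) => /fq.
Qed.

Lemma add_lb c i j x : i != j -> add (D c) i j x = lok c (lb i j x).
Proof. by move=> ij; rewrite /lb -lab_badd //; apply: plane_latin. Qed.

Lemma lbC i j x : i != j -> lb i j x = lb j i x.
Proof.
move=> ij; apply: lab_eq => c; rewrite -!/(lb _ _ _) -!add_lb // 1?eq_sym //.
exact: addC.
Qed.

Lemma lb_updl i j x a : lb i j (upd x i a) = lb i j x.
Proof. by rewrite /lb; congr lab; apply/funext => u; rewrite upd_upd. Qed.

Lemma lb_updr i j x a : i != j -> lb i j (upd x j a) = lb i j x.
Proof. by move=> ij; rewrite lbC // lb_updl lbC // eq_sym. Qed.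

Definition semi3 d i j k x := forall u,
  [/\ lok d (lb i j (upd x k u)), lok d (lb i k (upd x j u)) & lok d (lb j k (upd x i u))].

(* The subcube is a composition [F (h x_i x_j) x_k] in which [F] has the only colour [b]
   and [h] does not have it. *)
Definition strict3 (b : 'I_3) i j k x :=
  (forall u, [/\ ~~ lok b (lb i j (upd x k u)), lb i k (upd x j u) = Some b
               & lb j k (upd x i u) = Some b]) /\
  (exists u v, lb i j (upd x k u) != lb i j (upd x k v)).

Lemma cube_cases i j k x : i != j -> i != k -> j != k ->
  exists b : 'I_3, [\/ semi3 b i j k x, strict3 b i j k x, strict3 b i k j x | strict3 b j k i x].
Proof.
move=> ij ik jk; pose q (a b c : 'I_4) := f (upd (upd (upd x i a) j b) k c).
have E12 u : lab12 q u = lb i j (upd x k u).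
  rewrite /lab12 /lb; congr lab; apply/funext => a; apply/funext => b.
  by rewrite /q (updC _ _ _ jk) (updC _ _ _ ik).
have E13 u : lab13 q u = lb i k (upd x j u).
  rewrite /lab13 /lb; congr lab; apply/funext => a; apply/funext => b.
  by rewrite /q (updC _ _ _ ij).
have E23 u : lab23 q u = lb j k (upd x i u) by [].
have lq : latin3 q.
  split=> u v a a'; last exact: fq.
    by rewrite /q !(updC _ _ _ ij) !(updC _ _ _ ik) => /fq.
  by rewrite /q !(updC _ _ _ jk) => /fq.
have [b h] := latin3_rule lq; exists b.
have ji : j != i by rewrite eq_sym.
have ki : k != i by rewrite eq_sym.
have kj : k != j by rewrite eq_sym.
case: h => [h|[h e]|[h e]|[h e]].
- by apply: Or41 => u; have := h u; rewrite E12 E13 E23.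
- apply: Or42; split; first by move=> u; have := h u; rewrite E12 E13 E23.
  by have [u [v]] := e; exists u, v; rewrite -!E12.
- apply: Or43; split; last by have [u [v]] := e; exists u, v; rewrite -!E13.
  by move=> u; have := h u; rewrite E12 E13 E23 (lbC _ jk).
- apply: Or44; split; last by have [u [v]] := e; exists u, v; rewrite -!E23.
  by move=> u; have := h u; rewrite E12 E13 E23 (lbC _ ij) (lbC _ ik).
Qed.

(* In a semilinear subcube parallel planes related by a partner of the colour are equal up
   to the swap of this colour. *)
Lemma semi3_partner d i j k x a : i != j -> i != k -> j != k -> semi3 d i j k x ->
  D d (upd x k a) = D d x -> lb i j (upd x k a) = lb i j x.
Proof.
move=> ij ik jk hs e; have [->|na] := eqVneq a (x k); first by rewrite upd_id.
have ki : k != i by rewrite eq_sym.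
have kj : k != j by rewrite eq_sym.
have eik v u : D d (upd (upd (upd x j v) i u) k a) = D d (upd (upd x j v) i u)
    (+) (D d (upd (upd x j v) k a) (+) D d (upd x j v)).
  have [_ + _] := hs v; rewrite -add_lb // => /addP/(_ u a (x i) (x k)).
  rewrite (@upd_fix T (upd x j v) i (x i)) ?upd_other // 1?eq_sym //.
  rewrite !(@upd_fix T _ k (x k)) ?upd_other // 1?eq_sym //.
  by case: (D d _); case: (D d _); case: (D d _); case: (D d _).
have ejk v : D d (upd (upd x j v) k a) = D d (upd x j v).
  have [_ _] := hs (x i); rewrite upd_id -add_lb // => /addP/(_ v a (x j) (x k)).
  rewrite upd_id !(@upd_fix T _ k (x k)) ?upd_other // e.
  by case: (D d _); case: (D d _); case: (D d _).
have fe u v : f (upd (upd (upd x k a) i u) j v) = swp d (f (upd (upd x i u) j v)).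
  rewrite (updC _ _ _ ki) (updC _ _ _ kj) (updC _ _ _ ij).
  apply: (@pr_eq_neq d); first by rewrite -!/(D d _) eik ejk addbb addbF.
  apply: contra na => /eqP h; apply/eqP.
  move: h; rewrite -{2}(upd_id (upd (upd x j v) i u) k) => /fq ->.
  by rewrite !upd_other.
apply: lab_eq => c; rewrite -!/(lb _ _ _) -!add_lb //.
by apply/addP/addP => h u v u' v'; have := h u v u' v';
  rewrite /D !fe !pr_swp !(addbACA _ (c != d)) addbb !addbF.
Qed.

(* Take a closest pair [x], [y] and let [q i] be the colour partner of [y i]. In the cube spanned
   by the coordinates where [x] and [y] differ, the colour of [x] at [w] is given by the parity of
   the number of [i] with [w i] in [{y i, q i}]. Hence both colours agree on [y] and on [y] with
   one coordinate changed to [q i], against injectivity. *)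
Lemma closed_sets_meet S (X Y : {ffun T -> 'I_4} -> Prop) (kX kY : {ffun T -> 'I_4} -> 'I_3) :
    (exists x, X x) -> (exists y, Y y) ->
    (forall x y, X x -> Y y -> cube S x y) ->
    (forall x y, X x -> Y y -> kX x != kY y) ->
    (forall x i, X x -> i \in S -> (forall a, X (upd x i a)) \/
       exists a, [/\ a != x i, D (kX x) (upd x i a) = D (kX x) x, X (upd x i a)
                   & kX (upd x i a) = kX x]) ->
    (forall x i, Y x -> i \in S -> (forall a, Y (upd x i a)) \/
       exists a, [/\ a != x i, D (kY x) (upd x i a) = D (kY x) x, Y (upd x i a)
                   & kY (upd x i a) = kY x]) ->
  exists z, X z /\ Y z.
Proof.
move=> [x0 Xx0] [y0 Yy0] XYS kXY clX clY; apply: contrapT => nXY.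
pose df x y := [set i | x i != y i].
pose P m := `[< exists x y, [/\ X x, Y y & #|df x y| = m] >].
have exP : exists m, P m by exists #|df x0 y0|; apply/asboolP; exists x0, y0.
have [d0 /asboolP[x [y [Xx Yy dxy]]] d0min] := ex_minnP exP.
have far x' y' : X x' -> Y y' -> d0 <= #|df x' y'|.
  by move=> Xx' Yy'; apply: d0min; apply/asboolP; exists x', y'.
set S0 := df x y in dxy.
have S0P i : (i \in S0) = (x i != y i) by rewrite inE.
have S0S i : i \in S0 -> i \in S.
  by rewrite S0P; apply: contraR => /(cubeP _ _ _ (XYS _ _ Xx Yy)) ->.
have closer x' y' i : X x' -> Y y' -> i \in S0 -> x' i = y' i ->
    (forall j, j \notin S0 -> x' j = y' j) -> False.
  move=> Xx' Yy' iS e h; have := far _ _ Xx' Yy'; rewrite -dxy leqNgt => /negP; apply.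
  apply: proper_card; apply/properP; split.
    by apply/subsetP => j; rewrite inE; apply: contraR => /h ->.
  by exists i => //; rewrite inE e eqxx.
have xyS j : j \notin S0 -> x j = y j by rewrite S0P negbK => /eqP.
have [q hq] : {q : T -> 'I_4 | forall i, i \in S0 ->
    [/\ q i != y i, q i != x i, D (kY y) (upd y i (q i)) = D (kY y) y & Y (upd y i (q i))]}.
  suff h i : exists qi, i \in S0 -> [/\ qi != y i, qi != x i,
      D (kY y) (upd y i qi) = D (kY y) y & Y (upd y i qi)].
    by have [q hq] := choice h; exists q.
  have [iS|] := boolP (i \in S0); last by exists o0.
  have iy a j : j \notin S0 -> x j = upd y i a j.
    by move=> jS; rewrite upd_other ?xyS //; apply: contraNneq jS => ->.
  case: (clY _ _ Yy (S0S _ iS)) => [h|[a [na ea Ya _]]].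
    by case: (closer x (upd y i (x i)) i) => //; [rewrite upd_same|apply: iy].
  exists a => _; split=> //; apply/eqP => e.
  by case: (closer x (upd y i a) i) => //; [rewrite upd_same|apply: iy].
pose inB w := forall i, i \in S0 -> w i != y i /\ w i != q i.
have xB : inB x by move=> i iS; have [_ + _ _] := hq i iS; rewrite S0P in iS; rewrite eq_sym.
pose c := kX x.
(* By minimality no such move may reach [y i] or [q i]; closure then supplies the other value
   outside this pair. *)
have block w : cube S0 x w -> inB w -> [/\ X w, kX w = c & D c w = D c x].
  move=> xw wB; suff [] : inB w /\ [/\ X w, kX w = c & D c w = D c x] by [].
  move: xw; apply: (cube_ind (P := fun v => inB v /\ [/\ X v, kX v = c & D c v = D c x])).
    by split.
  move=> v i iS xv [vB [Xv kv Dv]].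
  have vyS j : j \notin S0 -> v j = y j by move=> jS; rewrite (cubeP _ _ _ xv) ?xyS.
  split.
    move=> j jS; have [->|ji] := eqVneq j i; first by rewrite upd_same; apply: (wB i iS).
    by rewrite upd_other //; apply: (vB j jS).
  have [->|nw] := eqVneq (w i) (v i); first by rewrite upd_id.
  have vi a j : j \notin S0 -> upd v i a j = y j.
    by move=> jS; rewrite upd_other ?vyS //; apply: contraNneq jS => ->.
  case: (clX _ _ Xv (S0S _ iS)) => [h|[a [na ea Xa ka]]].
    by case: (closer (upd v i (y i)) y i) => //; [rewrite upd_same|apply: vi].
  have [qy qx Dq Yq] := hq i iS; have [vy vq] := vB i iS; have [wy wq] := wB i iS.
  have ay : a != y i.
    by apply/eqP => e; case: (closer (upd v i a) y i) => //; [rewrite upd_same|apply: vi].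
  have aq : a != q i.
    apply/eqP => e; case: (closer (upd v i a) (upd y i (q i)) i) => //.
      by rewrite !upd_same.
    by move=> j jS; rewrite !upd_other ?vyS //; apply: contraNneq jS => ->.
  rewrite (@ord4_last (v i) (y i) (q i) a (w i)) // 1?eq_sym //.
  by rewrite kv in ka ea; rewrite ka ea Dv.
pose e w := [set i in S0 | (w i == y i) || (w i == q i)].
have eE u j : (j \in e u) = (j \in S0) && ((u j == y j) || (u j == q j)) by rewrite /e in_set.
(* On a line in a direction of [e w] the two values outside the pair are partners by induction, so
   the two inside take the opposite colour value. *)
have par w : cube S0 x w -> D c w = D c x (+) odd #|e w|.
  have [m] := ubnP #|e w|; elim: m w => // m IHm w; rewrite ltnS => em xw.
  have [e0|/set0Pn[i]] := eqVneq (e w) set0.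
    rewrite e0 cards0 addbF; have [//|_ _ ->//] := block w xw.
    move=> i iS; have : i \notin e w by rewrite e0 inE.
    by rewrite eE iS /= negb_or => /andP.
  move=> iew; have := iew; rewrite eE => /andP[iS wi].
  have [qy qx _ _] := hq i iS; rewrite eq_sym in qy.
  have [p1 [p2 [n12 n1y n1q [n2y n2q]]]] := ord4_compl qy.
  have ep p : p != y i -> p != q i -> e (upd w i p) = e w :\ i.
    move=> py pq; apply/setP => j; rewrite in_setD1 !eE; have [->|ji] := eqVneq j i.
      by rewrite upd_same (negPf py) (negPf pq) andbF.
    by rewrite upd_other.
  have ec : #|e w| = #|e w :\ i|.+1 by rewrite (cardsD1 i) iew.
  have Dp p : p != y i -> p != q i -> D c (upd w i p) = D c x (+) odd #|e w :\ i|.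
    by move=> py pq; rewrite IHm ?ep //; [rewrite -ltnS -ec|apply: cube_upd].
  have [a [na ea ha]] := D_balanced c w i p1.
  have ap : a = p2.
    apply/eqP/negPn/negP => n; have := ha p2; rewrite !Dp // eq_sym n12 eq_sym n.
    by move=> /(_ isT isT); case: (D c x); case: (odd _).
  have := ha (w i); rewrite upd_id Dp // ec /= addbN; apply.
    by case/orP: wi => /eqP ->; rewrite eq_sym.
  by rewrite ap; case/orP: wi => /eqP ->; rewrite eq_sym.
have [i iS] : exists i, i \in S0.
  apply: contrapT => h; apply: nXY; exists x; split=> //.
  suff -> : x = y by [].
  by apply/ffunP => i; apply: xyS; apply/negP => iS; apply: h; exists i.
have [qy qx Dq Yq] := hq i iS.
have xy : cube S0 x y by apply/cubeP => j /xyS ->.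
have ey : e y = S0 by apply/setP => j; rewrite eE eqxx andbT.
have eyq : e (upd y i (q i)) = S0.
  apply/setP => j; rewrite eE; have [->|ji] := eqVneq j i.
    by rewrite upd_same eqxx orbT andbT.
  by rewrite upd_other // eqxx andbT.
have Dc : D c (upd y i (q i)) = D c y by rewrite (par y) // ey (par (upd _ _ _)) ?eyq //; apply: cube_upd.
have := pr_inj (kXY _ _ Xx Yy) Dc Dq; rewrite -{2}(upd_id y i) => /fq.
by move/eqP; rewrite (negPf qy).
Qed.
End Quasigroup.

(** * Quasigroups are semilinear or reducible *)

Section Structure.
Variables (T : finType) (f : {ffun T -> 'I_4} -> 'I_4).
Hypothesis fq : quasi f.
Implicit Types (x y z w : {ffun T -> 'I_4}) (i j k l q : T) (a : 'I_4) (b c d e : 'I_3)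
  (S I J K : {set T}).

Local Notation D := (D f).
Local Notation lb := (lb f).

Lemma lb_ext i j x y : i != j -> (forall k, k != i -> k != j -> x k = y k) ->
  lb i j x = lb i j y.
Proof.
move=> ij h; rewrite -(lb_updl f i j x (y i)) -(lb_updr fq _ (y j) ij).
suff -> : upd (upd x i (y i)) j (y j) = y by [].
apply/ffunP => k; rewrite updE; case: eqP => [->//|/eqP kj].
by rewrite updE; case: eqP => [->//|/eqP ki]; apply: h.
Qed.

Definition crossadd c I := forall i j x, i \in I -> j \notin I -> add (D c) i j x.

Lemma crossaddC c I : crossadd c I -> crossadd c (~: I).
Proof.
move=> h i j x; rewrite !inE negbK => iI jI; rewrite addC; first exact: h.
by apply: contraNneq iI => ->.
Qed.

(** A composition without naming the inner operation: [I]-parts with equal values in one context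
    have equal values in every context. *)
Definition reduces I := forall y z w w', cube I z w -> cube I z w' ->
  f w = f w' -> f (mix I y w) = f (mix I y w').

Lemma mix_upd I y x i a : i \in I -> mix I y (upd x i a) = upd (mix I y x) i a.
Proof.
move=> iI; apply/ffunP => k; rewrite !(mixE, updE).
by case: eqP => [->|]; rewrite ?iI.
Qed.

(** A step along a level set of [c] applies [swp c] in both contexts, hence flips a second colour
    [d] in both. So [phi] is constant on connected level sets, and [c] and [d] together determine
    the value. *)
Lemma prime_factor c I z y : I != set0 -> prime (D c) I z ->
    (forall x i a, cube I z x -> i \in I ->
       D c (upd x i a) (+) D c x = D c (upd (mix I y x) i a) (+) D c (mix I y x)) ->
  forall w w', cube I z w -> cube I z w' -> f w = f w' -> f (mix I y w) = f (mix I y w').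
Proof.
move=> I0 pI h w w' zw zw' eww.
have [d dc] := other_colour c.
have sw x i a : a != x i -> D c (upd x i a) = D c x -> f (upd x i a) = swp c (f x).
  move=> na e; apply: (@pr_eq_neq c); first exact/esym.
  apply: contra na => /eqP e'; apply/eqP; move: e'.
  by rewrite -{2}(upd_id x i) => /fq.
pose phi x := pr d (f x) (+) pr d (f (mix I y x)).
have hphi x i a : cube I z x -> i \in I -> D c x = D c w -> D c (upd x i a) = D c w ->
    phi (upd x i a) = phi x.
  move=> zx iI Dx Da; have [->|na] := eqVneq a (x i); first by rewrite upd_id.
  have e1 := sw x i a na (etrans Da (esym Dx)).
  have e2 : f (mix I y (upd x i a)) = swp c (f (mix I y x)).
    rewrite mix_upd //; apply: sw; first by rewrite mixE iI.
    have := h x i a zx iI; rewrite Dx Da addbb.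
    by case: (D c (upd _ _ _)); case: (D c _).
  by rewrite /phi e1 e2 !pr_swp !(addbACA _ (d != c)) addbb !addbF.
have ed : pr d (f (mix I y w)) = pr d (f (mix I y w')).
  have := prime_conn (D_balanced fq c) I0 pI hphi zw zw' erefl.
  by rewrite /phi /D eww => /(_ erefl) /addbI.
have ec x : cube I z x -> D c x (+) D c (mix I y x) = D c z (+) D c (mix I y z).
  apply: (cube_ind (P := fun x => D c x (+) D c (mix I y x) = D c z (+) D c (mix I y z))) => //.
  move=> u i iI zu <-; rewrite mix_upd //; have := h u i (x i) zu iI.
  by case: (D c u); case: (D c _); case: (D c _); case: (D c _).
apply: (pr_inj (c := c) (d := d)) => //; first by rewrite eq_sym.
have := ec w' zw'; rewrite -(ec w zw) /D eww => /addbI; exact: esym.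
Qed.

(** By [prime_factor], [f] is here a binary operation on its value at [x q = z q] and the coordinate
    [q]; each of these planes shows this operation up to renaming the first argument. *)
Lemma prime_label c J z q : J != set0 -> prime (D c) J z -> q \notin J ->
    (forall j x, j \in J -> cube (q |: J) z x -> add (D c) j q x) ->
  forall j j' x x', j \in J -> j' \in J -> cube (q |: J) z x -> cube (q |: J) z x' ->
    lb j q x = lb j' q x'.
Proof.
move=> J0 pJ qJ h.
have zq x : cube (q |: J) z x -> cube J z (upd x q (z q)).
  move=> zx; apply/cubeP => k kJ; rewrite updE; case: eqP => [->//|/eqP kq].
  by rewrite (cubeP _ _ _ zx) // !inE negb_or kq.
have G w w' a : cube J z w -> cube J z w' -> f w = f w' -> f (upd w q a) = f (upd w' q a).
  have E u : cube J z u -> mix J (upd z q a) u = upd u q a.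
    move=> zu; apply/ffunP => k; rewrite mixE !updE; case: ifPn => [kJ|kJ].
      by case: eqP => // kq; rewrite -kq kJ in qJ.
    by case: eqP => // _; rewrite (cubeP _ _ _ zu).
  move=> zw zw' e; rewrite -(E w zw) -(E w' zw'); move: zw zw' e; apply: (prime_factor J0 pJ).
  move=> x i u zx iJ; rewrite E //.
  have iq : i != q by apply: contraNneq qJ => <-.
  have /addP/(_ u (x q) (x i) a) := h i x iJ (cube_sub (subsetUr _ _) zx).
  rewrite upd_id (@upd_fix _ (upd x i u) q (x q)) ?upd_id; last first.
    by rewrite upd_other // eq_sym.
  by move=> ->; rewrite (updC _ _ _ iq).
have key j j' x x' e : j \in J -> j' \in J -> cube J z x -> cube J z x' ->
    add (D e) j q x -> add (D e) j' q x'.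
  move=> jJ j'J zx zx' /addP hx; apply/addP.
  pose g a := f (upd x j a); have gI : injective g := @fq x j.
  pose tr a := invF gI (f (upd x' j' a)).
  have etr a v : f (upd (upd x' j' a) q v) = f (upd (upd x j (tr a)) q v).
    apply: G; rewrite ?cube_upd //.
    by rewrite -/(g (tr a)) /tr f_invF.
  by move=> a v a' v'; have := hx (tr a) v (tr a') v'; rewrite /D -!etr.
move=> j j' x x' jJ j'J zx zx'.
have jq : j != q by apply: contraNneq qJ => <-.
have j'q : j' != q by apply: contraNneq qJ => <-.
rewrite -(lb_updr fq x (z q) jq) -(lb_updr fq x' (z q) j'q).
apply: lab_eq => e; rewrite -!/(lb _ _ _) -!(add_lb fq) //.
by apply/idP/idP; apply: key; rewrite ?zq.
Qed.

(** If two single colours occurred on planes in direction [n], [closed_sets_meet] would give a point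
    carrying both, and the subcube in directions [i], [i'], [n] would have no common additive
    colour. *)
Lemma colour_isolated n : (forall i j k x, i != j -> i != k -> j != k -> exists d, semi3 f d i j k x) ->
  exists d, forall i x, i != n -> lok d (lb i n x).
Proof.
move=> hs; pose X d x := exists2 i, i != n & lb i n x = Some d.
have uni d d' : (exists x, X d x) -> (exists x, X d' x) -> d = d'.
  move=> Xd Xd'; apply/eqP/negPn/negP => dd'.
  have cl e x j : X e x -> j \in [set: T] -> (forall a, X e (upd x j a)) \/
      exists a, [/\ a != x j, D e (upd x j a) = D e x, X e (upd x j a) & e = e].
    case=> i ni le _; have [->|ji] := eqVneq j i.
      by left=> a; exists i; rewrite // lb_updl.
    have [->|jn] := eqVneq j n.
      by left=> a; exists i; rewrite // (lb_updr fq).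
    have ij : i != j by rewrite eq_sym.
    have nj : n != j by rewrite eq_sym.
    right; have [e' se] := hs i n j x ni ij nj.
    have ee : e' = e by have [+ _ _] := se (x j); rewrite upd_id le => /eqP.
    rewrite ee in se; have [a [na ea _]] := D_balanced fq e x j (x j).
    rewrite upd_id in ea; exists a; split=> //; exists i => //.
    by rewrite (semi3_partner fq ni ij nj se ea).
  have [x [[i ni li] [i' ni' li']]] := closed_sets_meet fq Xd Xd'
    (fun x y _ _ => introT (cubeP [set: T] x y) (fun j => ltac:(by rewrite inE)))
    (fun _ _ _ _ => dd') (@cl d) (@cl d').
  have ii' : i != i' by apply: contraNneq dd' => ei; move: li'; rewrite -ei li => -[->].
  have [e se] := hs i i' n x ii' ni ni'.
  have [_ + _] := se (x i'); rewrite upd_id li => /eqP de.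
  have [_ _] := se (x i); rewrite upd_id li' => /eqP de'.
  by rewrite de de' eqxx in dd'.
have [[d Xd]|nX] := EM (exists d, exists x, X d x).
  exists d => i x ni; case e: (lb i n x) => [d'|//].
  by apply/eqP; apply: uni Xd; exists x, i.
exists c0 => i x ni; case e: (lb i n x) => [d'|//].
by case: nX; exists d', x, i.
Qed.

(** * Maximal local compositions *)

(* [f] restricted to the subcube is [F (h x_I) x_q] with [F] of the only colour [c]. *)
Definition good I z q c := [/\ I != set0, q \notin I, prime (D c) I z &
  forall i x, i \in I -> cube (q |: I) z x -> lb i q x = Some c].

(** Supplies the good sets among which a largest one is chosen; the inner planes of a strict cube
    are non-additive, so their two directions are prime. *)
Lemma strict3_good c i j k x : i != j -> i != k -> j != k -> strict3 f c i j k x ->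
  good [set i; j] x k c.
Proof.
move=> ij ik jk [hs _]; split.
- by apply/set0Pn; exists i; rewrite !inE eqxx.
- by rewrite !inE negb_or ![k == _]eq_sym ik jk.
- have na u v : u \in [set i; j] -> v \in [set i; j] -> u != v -> ~~ add (D c) u v x.
    have n0 : ~~ add (D c) i j x by have [+ _ _] := hs (x k); rewrite upd_id -add_lb.
    rewrite !inE => /orP[]/eqP -> /orP[]/eqP ->; rewrite ?eqxx // => _.
    by rewrite addC // eq_sym.
  move=> S SI /set0Pn[u uS] SN.
  have /existsP[v /andP[vI vS]] : [exists v, (v \in [set i; j]) && (v \notin S)].
    apply: contraNT SN => /existsPn h; rewrite eqEsubset SI; apply/subsetP => v vI.
    by have := h v; rewrite vI negbK.
  exists u, v, x; split=> //; first exact: cube_refl.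
  by apply: na => //; [apply: (subsetP SI)|apply: contraNneq vS => <-].
- move=> u y; rewrite !inE => uI xy.
  have off l : l != i -> l != j -> l != k -> y l = x l.
    by move=> li lj lk; rewrite (cubeP _ _ _ xy) // !inE !negb_or lk li lj.
  case/orP: uI => /eqP ->.
    have [_ <- _] := hs (y j); apply: lb_ext => // l li lk; rewrite updE.
    by case: eqP => [->//|/eqP lj]; apply: off.
  have [_ _ <-] := hs (y i); apply: lb_ext => // l lj lk; rewrite updE.
  by case: eqP => [->//|/eqP li]; apply: off.
Qed.

Section MaximalGood.
Variables (I : {set T}) (c : 'I_3).
Hypothesis Imax : forall I' z' q' c', good I' z' q' c' -> #|I'| <= #|I|.

(* By maximality neither [l |: I] nor [q |: I] is good. If [c] is additive on the planes [q l], then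
   [l] splits off. Otherwise divide [I] by whether the planes with [l] have the label [c]: a proper
   division would contradict the primality of [I], and if none had it, [q |: I] would be good. *)
Lemma good_extend z q l : good I z q c -> l != q -> l \notin I ->
  forall i x, i \in I -> cube I z x -> lok c (lb i l x).
Proof.
move=> [I0 qI pI hq] lq lI.
have ql : q != l by rewrite eq_sym.
have nq i : i \in I -> i != q by move=> iI; apply: contraNneq qI => <-.
have nl i : i \in I -> i != l by move=> iI; apply: contraNneq lI => <-.
set U := l |: (q |: I).
have IU i : i \in I -> i \in U by rewrite /U !inE => ->; rewrite !orbT.
have cIU x : cube I z x -> cube U z x by apply: cube_sub; rewrite /U setUA subsetUr.
(* In the subcube in directions [i], [q], [l] the inner pair is [q], [l] in [PA] and [i], [q] in
   [PB]; the inner pair [i], [l] falls under the first alternative of [cases]. *)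
pose PA i x := (forall u, [/\ lb i q (upd x l u) = Some c, lb i l (upd x q u) = Some c
    & ~~ lok c (lb q l (upd x i u))]) /\ (exists u v, lb q l (upd x i u) != lb q l (upd x i v)).
pose PB i x := exists2 d, d != c & forall u, lb i l (upd x q u) = Some d /\ lb q l (upd x i u) = Some d.
have cases i x : i \in I -> cube U z x ->
    [\/ (forall u, lok c (lb i q (upd x l u)) /\ lok c (lb q l (upd x i u))), PA i x | PB i x].
  move=> iI zx; have iq := nq _ iI; have il := nl _ iI.
  have liq : lb i q (upd x l (z l)) = Some c.
    apply: hq => //; apply/cubeP => k; rewrite updE; case: eqP => [->//|/eqP kl] kI.
    by rewrite (cubeP _ _ _ zx) // /U in_setU1 negb_or kl.
  have [b [h|[h _]|[h _]|[h e]]] := cube_cases fq x iq il ql.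
  - apply: Or31 => u; have bc : c = b by have [+ _ _] := h (z l); rewrite liq => /eqP.
    by rewrite bc; have [? _ _] := h u; have [_ _ ?] := h u.
  - apply: Or33; exists b; last by move=> u; have [_ -> ->] := h u.
    by have [+ _ _] := h (z l); rewrite liq /= eq_sym.
  - apply: Or31 => u; have bc : b = c by have [_ + _] := h (z l); rewrite liq => -[].
    by have [_ -> +] := h u; rewrite lbC // bc => ->; rewrite /= eqxx.
  - have bc : b = c by have [_ + _] := h (z l); rewrite lbC // 1?eq_sym // liq => -[].
    apply: Or32; split=> // u; have [h1 h2 h3] := h u; rewrite bc in h1 h2 h3.
    by rewrite (lbC fq _ iq) (lbC fq _ il).
have Tinv x : cube U z x -> lok c (lb q l x) = lok c (lb q l z).
  apply: (cube_ind (P := fun x => lok c (lb q l x) = lok c (lb q l z))) => // w k kU zw <-.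
  move: kU; rewrite /U !inE => /or3P[/eqP ->|/eqP ->|kI].
  - by rewrite (lb_updr fq).
  - by rewrite lb_updl.
  case: (cases k w kI zw) => [h|[h _]|[d dc h]].
  - by have [_ ->] := h (x k); have [_] := h (w k); rewrite upd_id => ->.
  - have [_ _ /negPf ->] := h (x k); have [_ _] := h (w k); rewrite upd_id.
    by move=> /negPf ->.
  - by have [_ ->] := h (x k); have [_] := h (w k); rewrite upd_id => ->.
have [Tc|Tc] := boolP (lok c (lb q l z)).
  have h1 i x : i \in I -> cube U z x -> lok c (lb i q x).
    move=> iI zx; case: (cases i x iI zx) => [h|[h _]|[d dc h]].
    - by have [+ _] := h (x l); rewrite upd_id.
    - by have [_ _] := h (x i); rewrite upd_id Tinv ?Tc.
    - by have [_] := h (x i); have := Tinv x zx; rewrite Tc upd_id => + e; rewrite e /= (negPf dc).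
  have [pl|h] := prime_setU1 pI lI; last first.
    by move=> i x iI zx; rewrite -(add_lb fq) ?nl //; apply: h => //; apply: cube_sub zx; rewrite subsetUr.
  suff /Imax : good (l |: I) z q c by rewrite cardsU1 lI add1n ltnn.
  have qlI : q \notin l |: I by rewrite !inE negb_or ql.
  have lI0 : l |: I != set0 by apply/set0Pn; exists l; rewrite setU11.
  have eU : q |: (l |: I) = U by rewrite /U setUCA.
  have hadd j x : j \in l |: I -> cube (q |: (l |: I)) z x -> add (D c) j q x.
    rewrite eU !inE => /orP[/eqP ->|jI] zx; last by rewrite (add_lb fq) ?nq ?h1.
    by rewrite (add_lb fq) // lbC // Tinv.
  split=> // j x jI zx; case/set0Pn: I0 => i0 i0I.
  have i0l : i0 \in l |: I by rewrite !inE i0I orbT.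
  rewrite (prime_label lI0 pl qlI hadd jI i0l zx (cube_refl _ _)).
  by apply: hq => //; apply: cube_refl.
have nT x : cube U z x -> ~~ lok c (lb q l x) by move=> /Tinv ->.
pose A i x := lb i l x == Some c.
have AP i x : i \in I -> cube U z x -> A i x -> PA i x.
  move=> iI zx /eqP Ai; case: (cases i x iI zx) => [h|//|[d dc h]].
    by have [_] := h (x i); rewrite upd_id => h'; have := nT x zx; rewrite h'.
  by have [+ _] := h (x q); rewrite upd_id Ai => -[/eqP]; rewrite eq_sym (negPf dc).
have BP i x : i \in I -> cube U z x -> ~~ A i x -> PB i x.
  move=> iI zx nA; case: (cases i x iI zx) => [h|[h _]|//].
    by have [_] := h (x i); rewrite upd_id => h'; have := nT x zx; rewrite h'.
  by have [_ + _] := h (x q); rewrite upd_id => /eqP Ai; rewrite /A Ai in nA.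
have BE i x u : i \in I -> cube U z x -> ~~ A i x ->
    lb i l x = lb q l x /\ lb q l (upd x i u) = lb q l x.
  move=> iI zx nA; have [d dc h] := BP i x iI zx nA.
  have [+ _] := h (x q); have [_ +] := h (x i); have [_ ->] := h u.
  by rewrite !upd_id => -> ->.
have tau x : cube U z x -> exists2 t, lb q l x = Some t & t != c.
  by move=> /nT; case: (lb q l x) => // t tc; exists t.
have fact1 i k x : i \in I -> k \in I -> i != k -> cube U z x -> A i x -> ~~ A k x ->
    lok c (lb i k x).
  move=> iI kI ik zx Ai nAk; have il := nl _ iI; have kl := nl _ kI.
  have [t et tc] := tau x zx.
  have lk : lb k l x = Some t by have [-> _] := BE k x (x k) kI zx nAk.
  have li : lb i l x = Some c by apply/eqP.
  have [b [h|[h _]|[h _]|[h _]]] := cube_cases fq x ik il kl.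
  - have [_ + _] := h (x k); rewrite upd_id li => /eqP cb.
    by have [_ _] := h (x i); rewrite upd_id lk -cb /= (negPf tc).
  - have [_ + _] := h (x k); rewrite upd_id li => -[cb].
    by have [_ _] := h (x i); rewrite upd_id lk -cb => -[/eqP]; rewrite (negPf tc).
  (* With inner pair [i], [l] the label of the planes in directions [k], [l] is constant along [i];
     by [BE] it equals that of the planes in directions [q], [l], which varies by [PA]. *)
  - have bt : b = t.
      by have [_ _] := h (x i); rewrite upd_id lbC // 1?eq_sym // lk => -[].
    have [_ [u [v uv]]] := AP i x iI zx Ai.
    have [u' hu'] : exists u', lb q l (upd x i u') != lb q l x.
      have [e|] := eqVneq (lb q l (upd x i u)) (lb q l x); last by exists u.
      by exists v; rewrite -e eq_sym.
    have zx' : cube U z (upd x i u') by apply: cube_upd; rewrite ?IU.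
    have lk' : lb k l (upd x i u') = Some t.
      by have [_ _] := h u'; rewrite lbC // 1?eq_sym // bt.
    have nAk' : ~~ A k (upd x i u').
      by rewrite /A lk'; apply: contra tc => /eqP[->].
    have [e _] := BE k _ u kI zx' nAk'.
    by move: hu'; rewrite -e lk' et eqxx.
  - have bc : b = c by have [_ _] := h (x k); rewrite upd_id lbC // 1?eq_sym // li => -[].
    have [_ + _] := h (x l); rewrite upd_id lbC // 1?eq_sym // => ->.
    by rewrite bc /= eqxx.
have fact2 i k x u : i \in I -> k \in I -> i != k -> cube U z x -> A i x -> A i (upd x k u).
  move=> iI kI ik zx Ai; have il := nl _ iI; have kl := nl _ kI.
  have li : lb i l x = Some c by apply/eqP.
  have zx' : cube U z (upd x k u) by apply: cube_upd; rewrite ?IU.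
  apply: contrapT => /negP nA'.
  have [t et tc] := tau _ zx'.
  have li' : lb i l (upd x k u) = Some t by have [-> _] := BE i _ u iI zx' nA'.
  have [b [h|[h _]|[h _]|[h _]]] := cube_cases fq x ik il kl.
  - have [_ + _] := h (x k); rewrite upd_id li => /eqP cb.
    by have [_ + _] := h u; rewrite li' -cb /= (negPf tc).
  - have [_ + _] := h (x k); rewrite upd_id li => -[cb].
    by have [_ + _] := h u; rewrite li' -cb => -[/eqP]; rewrite (negPf tc).
  - have lk : lb k l x = Some b.
      by have [_ _] := h (x i); rewrite upd_id lbC // 1?eq_sym.
    have [+ _ _] := h (x k); rewrite upd_id li => cb.
    have nAk : ~~ A k x by rewrite /A lk; apply: contra cb => /eqP[->] /=.
    have [e1 e2] := BE k x u kI zx nAk.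
    have [+ _ _] := h u; rewrite li'.
    by move: et; rewrite e2 -e1 lk => -[->]; rewrite /= eqxx.
  - have [_ _] := h (x k); rewrite upd_id lbC // 1?eq_sym // li => -[cb].
    have [_ _] := h u; rewrite lbC // 1?eq_sym // li' -cb => -[/eqP].
    by rewrite (negPf tc).
have Ainv i x : i \in I -> cube U z x -> A i x = A i z.
  move=> iI; have il := nl _ iI.
  apply: (cube_ind (P := fun x => A i x = A i z)) => // w k kU zw <-.
  have [->|ki] := eqVneq k i; first by rewrite /A lb_updl.
  have zw' : cube U z (upd w k (x k)) by apply: cube_upd.
  move: kU; rewrite /U !inE => /or3P[/eqP ek|/eqP ek|kI].
  - by rewrite /A ek (lb_updr fq).
  - rewrite ek; apply/idP/idP => [Aw|/(AP i w iI zw)[h _]]; last by rewrite /A; have [_ -> _] := h (x q).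
    rewrite ek in zw'.
    by have [h _] := AP i _ iI zw' Aw; have [_ + _] := h (w q); rewrite upd_upd upd_id => /eqP.
  - have ik : i != k by rewrite eq_sym.
    apply/idP/idP; last exact: fact2.
    by move=> /(fact2 i k _ (w k) iI kI ik zw'); rewrite upd_upd upd_id.
pose I1 := [set i in I | A i z].
have I1I : I1 \subset I by apply/subsetP => i; rewrite inE => /andP[].
have [e1|n1] := eqVneq I1 I.
  move=> i x iI zx; have : A i x.
    by rewrite Ainv ?cIU //; move: iI; rewrite -{1}e1 inE => /andP[].
  by rewrite /A => /eqP ->; rewrite /= eqxx.
have [e0|n0] := eqVneq I1 set0.
  have nA i x : i \in I -> cube U z x -> ~~ A i x.
    move=> iI zx; rewrite Ainv //; apply/negP => Ai.
    by have := in_set0 i; rewrite -e0 inE iI Ai.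
  have [t et tc] := tau z (cube_refl _ _).
  have Tt x : cube U z x -> lb q l x = Some t.
    apply: (cube_ind (P := fun x => lb q l x = Some t)) => // w k kU zw hw.
    move: kU; rewrite /U !inE => /or3P[/eqP ->|/eqP ->|kI].
    - by rewrite (lb_updr fq).
    - by rewrite lb_updl.
    - by have [_ ->] := BE k w (x k) kI zw (nA k w kI zw).
  suff /Imax : good (q |: I) z l t by rewrite cardsU1 qI add1n ltnn.
  have nadd i : i \in I -> ~~ add (D t) i q z.
    by move=> iI; rewrite (add_lb fq) ?nq // hq ?cube_refl //= eq_sym.
  split.
  - by apply/set0Pn; exists q; rewrite setU11.
  - by rewrite !inE negb_or lq.
  - move=> S SI /set0Pn[u uS] SN.
    have [v vI vS] : exists2 v, v \in q |: I & v \notin S.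
      apply: contrapT => h; case/negP: SN; rewrite eqEsubset SI; apply/subsetP => v vI.
      by apply: contrapT => /negP vS; apply: h; exists v.
    have [qS|qS] := boolP (q \in S).
      have vI' : v \in I.
        by move: vI; rewrite !inE => /orP[/eqP vq|//]; rewrite vq qS in vS.
      exists q, v, z; split=> //; first exact: cube_refl.
      by rewrite addC ?nadd // eq_sym nq.
    have uI' : u \in I.
      have := subsetP SI u uS; rewrite !inE => /orP[/eqP uq|//].
      by rewrite uq (negPf qS) in uS.
    exists u, q, z; split; rewrite ?setU11 ?nadd //; exact: cube_refl.
  - move=> i x; rewrite !inE => /orP[/eqP ->|iI] zx; first exact: Tt.
    by have [-> _] := BE i x (x i) iI zx (nA i x iI zx); apply: Tt.
have [i [k [x [iS kI kS zx]]]] := pI I1 I1I n0 n1.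
have ik : i != k by apply: contraNneq kS => <-.
have iI := subsetP I1I i iS.
rewrite (add_lb fq) // => /negP[]; apply: fact1; rewrite ?cIU //.
  by rewrite Ainv ?cIU //; move: iS; rewrite inE => /andP[].
by rewrite Ainv ?cIU //; move: kS; rewrite inE kI.
Qed.

(* Let [K] be maximal such that [c] is additive on all planes of the [I :|: K]-subcube across [I]
   and [K]. If some [l] could not be added, [closed_sets_meet] would give a point at which the
   label [c] of a plane across [I] and [K] contradicts [good_extend]. *)
Lemma good_crossadd z q : good I z q c -> crossadd c I.
Proof.
move=> gI; have [I0 qI pI hq] := gI.
pose H (K : {set T}) := `[< [/\ q \in K, [disjoint I & K] & forall i k x, i \in I -> k \in K ->
  cube (I :|: K) z x -> add (D c) i k x] >].
have Hq : H [set q].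
  apply/asboolP; split; first by rewrite inE.
    by rewrite disjoint_sym disjoints1.
  move=> i k x iI; rewrite inE => /eqP ->; rewrite setUC => zx.
  have iq : i != q by apply: contraNneq qI => <-.
  by rewrite (add_lb fq) // hq //= eqxx.
case: (@arg_maxnP _ _ H (fun K => #|K|) Hq) => K /asboolP[qK dK hK] Kmax.
have IK i : i \in I -> i \notin K by move=> iI; rewrite (disjointFr dK iI).
have KI k : k \in K -> k \notin I by move=> kK; rewrite (disjointFl dK kK).
have [eK|nK] := eqVneq (I :|: K) setT.
  move=> i j x iI jI; apply: hK => //.
    by have := in_setT j; rewrite -eK inE (negPf jI).
  by rewrite eK; apply/cubeP => k; rewrite inE.
have [l lI lK] : exists2 l, l \notin I & l \notin K.
  apply: contrapT => h; case/negP: nK; rewrite eqEsubset subsetT; apply/subsetP => l _.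
  rewrite inE; apply: contrapT => /negP; rewrite negb_or => /andP[lI lK].
  by apply: h; exists l.
have nl i : i \in I -> i != l by move=> iI; apply: contraNneq lI => <-.
have nIK i k : i \in I -> k \in K -> i != k.
  by move=> iI kK; apply: contraTneq kK => <-; apply: IK.
have KU k : k \in K -> k \in I :|: K by rewrite inE orbC => ->.
have pr x : cube (I :|: K) z x -> prime (D c) I x.
  apply: (cube_ind (P := prime (D c) I)) => // w k kU zw pw.
  have [kI|kI] := boolP (k \in I).
    by apply: prime_cube pw; apply: cube_upd => //; apply: cube_refl.
  have kK : k \in K by move: kU; rewrite inE (negPf kI).
  have hw i y : i \in I -> cube (k |: I) w y -> add (D c) i k y.
    move=> iI wy; apply: hK => //; apply: cube_trans zw (cube_sub _ wy).
    by rewrite subUset sub1set kU subsetUl.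
  have [e he] := cross_diff (x k) kI hw.
  exact: prime_shift he kI pw.
suff main i x : i \in I -> cube (I :|: K) z x -> lok c (lb i l x).
  have : H (l |: K).
    apply/asboolP; split; first by rewrite !inE qK orbT.
      by rewrite -setI_eq0 setIUr setU_eq0 setIC setI_eq0 disjoints1 lI setI_eq0.
    move=> i k x iI; rewrite setUCA => kK zx.
    pose x0 := upd x l (z l).
    have zx0 : cube (I :|: K) z x0.
      apply/cubeP => m mU; rewrite updE; case: eqP => [->//|/eqP ml].
      by rewrite (cubeP _ _ _ zx) // inE negb_or inE ml.
    have il := nl _ iI.
    move: kK; rewrite !inE => /orP[/eqP ->|kK].
      by rewrite (add_lb fq) // -(lb_updr fq x (z l) il) main.
    have ik := nIK _ _ iI kK.
    have lk : l != k by apply: contraNneq lK => ->.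
    have /addP h0 := hK i k x0 iI kK zx0.
    have hl u : add (D c) i l (upd x k u).
      rewrite (add_lb fq) // -(lb_updr fq _ (z l) il) -(updC _ _ _ lk).
      by apply: main => //; apply: cube_upd => //; apply: KU.
    (* Differences of the colour along [i] do not depend on [l], so additivity carries over from
       [x0] to [x]. *)
    pose p a u := D c (upd (upd x i a) k u); pose p0 a u := D c (upd (upd x0 i a) k u).
    have E a a' u : p a u (+) p a' u = p0 a u (+) p0 a' u.
      have /addP/(_ a (x l) a' (z l)) := hl u.
      have F v : upd (upd (upd x k u) i v) l (x l) = upd (upd x i v) k u.
        by rewrite -(updC _ _ _ ik) upd_fix // !upd_other // eq_sym.
      have F0 v : upd (upd (upd x k u) i v) l (z l) = upd (upd x0 i v) k u.
        by rewrite /x0 -(updC _ _ _ ik) -(updC _ _ _ lk) -(updC _ _ _ il).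
      by rewrite !F !F0.
    by apply/addP => a u a' u'; rewrite -!/(p _ _) !E; apply: h0.
  by move=> /Kmax; rewrite /= cardsU1 lK add1n ltnn.
move=> iI zx; apply: contrapT => /negP nx.
(* Freezing the [I]-part leaves only directions of [K] to move. A point of [X] is again a good place
   for [I], which makes [good_extend] applicable there. *)
pose X y := [/\ cube (I :|: K) z y, forall j, j \in I -> y j = x j &
  exists j k, [/\ j \in I, k \in K & lb j k y = Some c]].
pose Y y := [/\ cube (I :|: K) z y, forall j, j \in I -> y j = x j & ~~ lok c (lb i l y)].
have updI y k a : k \in K -> (forall j, j \in I -> y j = x j) ->
    forall j, j \in I -> upd y k a j = x j.
  by move=> kK h j jI; rewrite upd_other ?h // nIK.
have XY y : X y -> Y y -> False.
  move=> [zy _ [j [k [jI kK ljk]]]] [_ _ /negP[]].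
  have gy : good I y k c.
    split=> //; [exact: KI|exact: pr|move=> u w uI yw].
    rewrite -ljk; apply: (prime_label I0 (pr y zy) (KI _ kK)) => //; last exact: cube_refl.
    move=> v t vI yt; apply: hK => //; apply: cube_trans zy (cube_sub _ yt).
    by rewrite subUset sub1set KU ?subsetUl.
  apply: (good_extend gy) => //; last exact: cube_refl.
  by apply: contraNneq lK => ->.
have [y [Xy Yy]] : exists y, X y /\ Y y; last exact: XY Xy Yy.
(* The default [c] is never reached: on [Y] the label is not [None]. *)
apply: (closed_sets_meet fq (S := K) (kX := fun=> c) (kY := fun y => odflt c (lb i l y))).
- case/set0Pn: I0 => j jI; exists (mix I z x); split.
  + by apply: cube_sub (cube_mix I z z x); rewrite subsetUl.
  + by move=> u uI; rewrite mixE uI.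
  + exists j, q; split=> //; apply: hq => //.
    by apply: cube_sub (cube_mix I z z x); rewrite subsetUr.
- by exists x.
- move=> u v [zu eu _] [zv ev _]; apply/cubeP => k kK.
  have [kI|kI] := boolP (k \in I); first by rewrite eu ?ev.
  by rewrite (cubeP _ _ _ zu) ?(cubeP _ _ _ zv) // inE negb_or kI.
- by move=> u v _ [_ _]; case: (lb i l v) => //= e; rewrite eq_sym.
- move=> u k' [zu eu [j [k [jI kK ljk]]]] k'K.
  have jk := nIK _ _ jI kK; have jk' := nIK _ _ jI k'K.
  have zu' a : cube (I :|: K) z (upd u k' a) by apply: cube_upd; rewrite ?KU.
  have whole : (forall a, lb j k (upd u k' a) = Some c) -> forall a, X (upd u k' a).
    by move=> h a; split=> //; [apply: updI|exists j, k].
  have [ekk|nkk] := eqVneq k' k; first by left; apply: whole => a; rewrite ekk (lb_updr fq).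
  rewrite eq_sym in nkk.
  have lc : lok c (lb j k' u) by rewrite -(add_lb fq) // hK.
  have [b [h|[h _]|[h _]|[h _]]] := cube_cases fq u jk jk' nkk.
  + right; have bc : b = c by have [+ _ _] := h (u k'); rewrite upd_id ljk => /eqP.
    rewrite bc in h; have [a [na ea _]] := D_balanced fq c u k' (u k').
    rewrite upd_id in ea; exists a; split=> //; split=> //; first exact: updI.
    by exists j, k; rewrite (semi3_partner fq jk jk' nkk h ea).
  + have [_ + _] := h (u k); rewrite upd_id => e; move: lc; rewrite e => /eqP bc.
    by have [+ _ _] := h (u k'); rewrite upd_id ljk bc /= eqxx.
  + left; apply: whole => a; have [_ -> _] := h a.
    by have [_ + _] := h (u k'); rewrite upd_id ljk.
  + left; apply: whole => a; have [_ + _] := h a; rewrite lbC // 1?eq_sym // => ->.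
    by have [_ + _] := h (u k'); rewrite upd_id lbC // 1?eq_sym // ljk.
- move=> u k [zu eu nu] kK; have il := nl _ iI; have ik := nIK _ _ iI kK.
  have lk : l != k by apply: contraNneq lK => ->.
  have kl : k != l by rewrite eq_sym.
  have zu' a : cube (I :|: K) z (upd u k a) by apply: cube_upd; rewrite ?KU.
  have lc : lok c (lb i k u) by rewrite -(add_lb fq) // hK.
  have whole : (forall a, ~~ lok c (lb i l (upd u k a))) -> forall a, Y (upd u k a).
    by move=> h a; split=> //; apply: updI.
  have [e le ec] : exists2 e, lb i l u = Some e & e != c.
    by move: nu; case: (lb i l u) => // e ec; exists e.
  rewrite le /=.
  have [b [h|[h _]|[h _]|[h _]]] := cube_cases fq u il ik lk.
  + right; have be : b = e by have [+ _ _] := h (u k); rewrite upd_id le => /eqP.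
    rewrite be in h; have [a [na ea _]] := D_balanced fq e u k (u k).
    rewrite upd_id in ea; have lea := semi3_partner fq il ik lk h ea.
    by exists a; rewrite lea le; split=> //; split=> //; [apply: updI|rewrite lea].
  + left; apply: whole => a; have [+ _ _] := h a.
    by have [_ + _] := h (u l); rewrite upd_id => e'; move: lc; rewrite e' => /eqP ->.
  + left; apply: whole => a; have [_ -> _] := h a.
    by have [_ + _] := h (u k); rewrite upd_id le => -[<-].
  + left; apply: whole => a; have [_ + _] := h a; rewrite lbC // 1?eq_sym // => ->.
    by have [_ + _] := h (u k); rewrite upd_id lbC // 1?eq_sym // le => -[<-].
Qed.
End MaximalGood.

(** A strict cube yields a good set, and a largest one is cut off by [good_crossadd]; it is proper
    because [q] lies outside. Without strict cubes a single direction is cut off. *)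
Lemma decomposable i0 j0 : i0 != j0 ->
  exists c I, [/\ I != set0, I != setT & crossadd c I].
Proof.
move=> ij.
have [[c [i [j [k [x [nij nik njk hs]]]]]]|ns] :=
    EM (exists c i j k x, [/\ i != j, i != k, j != k & strict3 f c i j k x]).
  pose P m := `[< exists I z q c, good I z q c /\ #|I| = m >].
  have exP : exists m, P m.
    exists #|[set i; j]|; apply/asboolP; exists [set i; j], x, k, c; split=> //.
    exact: strict3_good.
  have ubP m : P m -> m <= #|T|.
    by move/asboolP=> [I [z [q [d [_ <-]]]]]; apply: max_card.
  have [m /asboolP[I [z [q [d [gI eI]]]]] mmax] := ex_maxnP exP ubP.
  exists d, I; have [I0 qI _ _] := gI; split=> //.
    by apply: contraNneq qI => ->; rewrite inE.
  apply: good_crossadd gI => I' z' q' c' gI'; rewrite eI; apply: mmax.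
  by apply/asboolP; exists I', z', q', c'.
have hs i j k x : i != j -> i != k -> j != k -> exists d, semi3 f d i j k x.
  move=> nij nik njk; have [b [h|h|h|h]] := cube_cases fq x nij nik njk.
  - by exists b.
  - by case: ns; exists b, i, j, k, x.
  - by case: ns; exists b, i, k, j, x; rewrite eq_sym in njk.
  - by case: ns; exists b, j, k, i, x; split; rewrite // eq_sym.
have [d hd] := colour_isolated i0 hs.
exists d, [set i0]; split.
- by apply/set0Pn; exists i0; rewrite inE.
- by apply/eqP => e; have := in_setT j0; rewrite -e inE eq_sym (negPf ij).
- move=> i j x; rewrite !inE => /eqP -> ji; rewrite addC // 1?eq_sym //.
  by rewrite (add_lb fq) // hd.
Qed.

(** Moving a coordinate outside [I] adds a constant to the colour on the [I]-layer. *)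
Lemma crossadd_indep c I i j x y : crossadd c I -> i \in I -> j \in I -> cube (~: I) x y ->
  add (D c) i j y = add (D c) i j x.
Proof.
move=> hI iI jI; apply: (cube_ind (P := fun y => add (D c) i j y = add (D c) i j x)) => //.
move=> w k; rewrite inE => kI xw <-.
have ki : k != i by apply: contraNneq kI => ->.
have kj : k != j by apply: contraNneq kI => ->.
have [e he] := cross_diff (y k) kI (fun u v uI (_ : cube (k |: I) w v) => hI u k v uI kI).
by apply/addP/addP => h a b a' b'; have := h a b a' b';
  rewrite !(updC _ _ _ ki) !(updC _ _ _ kj) !he ?cube_upd ?cube_refl //;
  rewrite !(addbACA _ e) addbb !addbF.
Qed.

(** Take a smallest set containing [i] that [c] cuts off; it contains [j] too. A cut of its graph in
    one context is a cut in all, so the part containing [i] would be smaller. *)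
Lemma crossadd_prime c S i j x : crossadd c S -> S != set0 -> S != setT ->
    i != j -> ~~ add (D c) i j x ->
  exists I, [/\ 1 < #|I|, I != setT, crossadd c I & forall z, prime (D c) I z].
Proof.
move=> hS S0 ST ij na.
have stay I : crossadd c I -> i \in I -> j \in I.
  by move=> hI iI; apply: contraNT na => jI; apply: hI.
pose P I := `[< [/\ i \in I, I != setT & crossadd c I] >].
have [I0 PI0] : exists I, P I.
  have [iS|iS] := boolP (i \in S); first by exists S; apply/asboolP.
  exists (~: S); apply/asboolP; split; first by rewrite inE.
    by rewrite -setC0 (inj_eq (@setC_inj T)).
  exact: crossaddC.
case: (@arg_minnP _ _ P (fun I => #|I|) PI0) => I /asboolP[iI IT hI] Imin.
have jI := stay I hI iI.
exists I; split=> //.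
  by rewrite (cardsD1 i) iI (cardsD1 j) !inE jI eq_sym ij.
move=> z S' S'I S'0 S'N; apply: contrapT => np.
have hadd u v : u \in S' -> v \in I -> v \notin S' -> forall y, add (D c) u v y.
  move=> uS vI vS y; have uI := subsetP S'I u uS.
  have yI : cube (~: I) (mix I z y) y.
    by apply/cubeP => k; rewrite inE negbK mixE => ->.
  rewrite (crossadd_indep hI uI vI yI).
  apply: contrapT => /negP nadd; apply: np.
  by exists u, v, (mix I z y); split=> //; apply: cube_mix.
have hS' : crossadd c S'.
  move=> u v y uS vS; have [vI|vI] := boolP (v \in I); first exact: hadd.
  by apply: hI => //; apply: (subsetP S'I).
have hD : crossadd c (I :\: S').
  move=> u v y; rewrite !inE => /andP[uS uI] /nandP[|vI]; last exact: hI.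
  rewrite negbK => vS; rewrite addC; first exact: hadd.
  by apply: contraNneq uS => ->.
have small J : J \subset I -> J != I -> J != set0 -> i \in J -> crossadd c J -> False.
  move=> JI JN J0 iJ hJ.
  have /Imin : P J.
    apply/asboolP; split=> //; apply/eqP => e; case/negP: IT.
    by rewrite eqEsubset subsetT -e.
  by rewrite /= leqNgt proper_card // properEneq JN.
have [iS|iS] := boolP (i \in S'); first exact: (small S').
apply: (small (I :\: S')) => //; rewrite ?subsetDl //.
- apply: contraNneq S'0 => e; rewrite -subset0; apply/subsetP => k kS.
  by have := subsetP S'I k kS; rewrite -{1}e inE kS.
- by apply/set0Pn; exists i; rewrite inE iS.
- by rewrite inE iS.
Qed.

Lemma semilinear_or_reducible :
  (exists c, forall i j x, i != j -> add (D c) i j x) \/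
  (exists I, [/\ 1 < #|I|, I != setT & reduces I]).
Proof.
have [|ns] := EM (exists c, forall i j x, i != j -> add (D c) i j x); [by left|right].
have na c : exists i j x, i != j /\ ~~ add (D c) i j x.
  apply: contrapT => h; apply: ns; exists c => i j x ij.
  by apply: contrapT => /negP nadd; apply: h; exists i, j, x.
have [i0 [j0 [_ [ij0 _]]]] := na c0.
have [c [S [S0 ST hS]]] := decomposable ij0.
have [i [j [x [ij nadd]]]] := na c.
have [I [I2 IT hI pI]] := crossadd_prime hS S0 ST ij nadd.
exists I; split=> // y z; apply: prime_factor (pI z) _.
  by rewrite -card_gt0 ltnW.
move=> u k a zu kI.
have key v : cube (~: I) u v -> D c (upd v k a) (+) D c v = D c (upd u k a) (+) D c u.
  apply: (cube_ind (P := fun v => D c (upd v k a) (+) D c v = D c (upd u k a) (+) D c u)) => //.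
  move=> w l; rewrite inE => lI uw <-.
  have kl : k != l by apply: contraNneq lI => <-.
  have /addP/(_ a (v l) (w k) (w l)) := hI k l w kI lI.
  rewrite upd_id (@upd_fix _ (upd w k a) l (w l)); last by rewrite upd_other // eq_sym.
  by rewrite upd_id => <-; rewrite (updC _ _ _ kl).
by rewrite key //; apply/cubeP => l; rewrite inE negbK mixE => ->.
Qed.
End Structure.

(** * Counting reducible quasigroups *)

Lemma is_quasigroupP n (q : {ffun word n -> 'I_4}) : reflect (quasi q) (is_quasigroup q).
Proof.
apply: (iffP idP) => [/forallP h x i a b e|h].
  apply/eqP/negPn/negP => ab.
  have /forallP/(_ (upd x i b)) := h (upd x i a).
  have -> : differ_in_one (upd x i a) (upd x i b).
    apply/cards1P; exists i; apply/setP => j; rewrite !inE !updE.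
    by case: (j == i); rewrite ?ab ?eqxx.
  by rewrite e eqxx.
apply/forallP => c; apply/forallP => c'; apply/implyP => /cards1P[i hi].
have ci j : j != i -> c j = c' j.
  move=> ji; apply/eqP/negPn/negP => ne.
  by have : j \in [set i]; [rewrite -hi inE|rewrite inE (negPf ji)].
have ne : c i != c' i by have := set11 i; rewrite -hi inE.
have ec' : c' = upd c i (c' i).
  by apply/ffunP => j; rewrite updE; case: eqP => [->//|/eqP /ci].
apply: contra ne => /eqP; rewrite ec' -{1}(upd_id c i) => /h ->.
by rewrite upd_same.
Qed.

Definition quasis (T : finType) : {set {ffun {ffun T -> 'I_4} -> 'I_4}} :=
  [set q : {ffun {ffun T -> 'I_4} -> 'I_4} | `[< quasi q >]].

Lemma quasisP (T : finType) (q : {ffun {ffun T -> 'I_4} -> 'I_4}) :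
  reflect (quasi q) (q \in quasis T).
Proof. by rewrite inE; apply: asboolP. Qed.

Lemma card_quasis n : #|quasis 'I_n| = Q n.
Proof.
rewrite /Q; apply: eq_card => q; rewrite [RHS]inE.
exact: sameP (quasisP q) (is_quasigroupP q).
Qed.

Lemma quasi_comp (T U : finType) (f : {ffun T -> 'I_4} -> 'I_4)
    (ext : {ffun U -> 'I_4} -> {ffun T -> 'I_4}) (g : U -> T) :
    (forall w u a, ext (upd w u a) = upd (ext w) (g u) a) ->
  quasi f -> quasi (fun w => f (ext w)).
Proof. by move=> h fq w u a b; rewrite !h => /fq. Qed.

Lemma card_quasis_le (T : finType) : #|quasis T| <= Q #|T|.
Proof.
rewrite -card_quasis.
pose ext (w : {ffun 'I_#|T| -> 'I_4}) := [ffun t : T => w (enum_rank t)].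
pose r (q : {ffun {ffun T -> 'I_4} -> 'I_4}) := [ffun w => q (ext w)].
have r_inj : injective r.
  move=> q q' /ffunP e; apply/ffunP => x.
  have := e [ffun i => x (enum_val i)]; rewrite !ffunE.
  suff -> : ext [ffun i => x (enum_val i)] = x by [].
  by apply/ffunP => t; rewrite !ffunE enum_rankK.
rewrite -(card_imset _ r_inj); apply/subset_leq_card/subsetP => _ /imsetP[q /quasisP qq ->].
apply/quasisP; have -> : (r q : _ -> _) = fun w => q (ext w).
  by apply/funext => w; rewrite ffunE.
apply: (quasi_comp (g := enum_val)) => // w u a; apply/ffunP => t.
by rewrite !ffunE -(inj_eq enum_val_inj) enum_rankK.
Qed.

Section Restriction.
Variables (T : finType) (I : {set T}).

Definition ext (w : {ffun {i | i \in I} -> 'I_4}) : {ffun T -> 'I_4} :=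
  [ffun i => if insub i is Some u then w u else o0].

Definition restrict (q : {ffun {ffun T -> 'I_4} -> 'I_4}) := [ffun w => q (ext w)].

Lemma restrict_quasi q : q \in quasis T -> restrict q \in quasis _.
Proof.
move=> /quasisP qq; apply/quasisP.
have -> : (restrict q : _ -> _) = fun w => q (ext w) by apply/funext => w; rewrite ffunE.
apply: (quasi_comp (g := val)) => // w u a; apply/ffunP => i; rewrite !ffunE.
case: insubP => [v _ <-|iI]; first by rewrite !ffunE (inj_eq val_inj).
by case: eqP iI => // ->; rewrite (valP u).
Qed.

Lemma restrict_eq q q' x : restrict q = restrict q' -> cube I [ffun=> o0] x -> q x = q' x.
Proof.
move=> /ffunP e /cubeP xI; have := e [ffun u => x (val u)]; rewrite !ffunE.
suff -> : ext [ffun u => x (val u)] = x by [].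
apply/ffunP => i; rewrite !ffunE; case: insubP => [v _ <-|iI]; first by rewrite ffunE.
by rewrite xI // ffunE.
Qed.

Lemma card_restrict : #|quasis {i | i \in I}| <= Q #|I|.
Proof. by apply: leq_trans (card_quasis_le _) _; rewrite card_sig. Qed.
End Restriction.

(* A reducible quasigroup is recovered from its restrictions to [I] and to the complement of [I]
   enlarged by one element of [I], through which the inner operation is read off. *)
Lemma card_reduces n (I : {set 'I_n}) : 0 < #|I| ->
  #|[set q in quasis 'I_n | `[< reduces q I >]]| <= Q #|I| * Q (n - #|I|).+1.
Proof.
move=> /card_gt0P[i0 i0I]; set R := [set _ in _ | _].
pose J := i0 |: ~: I.
have cJ : #|J| = (n - #|I|).+1.
  by rewrite cardsU1 inE i0I /= add1n cardsCs setCK card_ord.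
pose Phi q := (restrict I q, restrict J q).
have Phi_inj : {in R &, injective Phi}.
  move=> q q'; rewrite !inE => /andP[qq /asboolP rq] /andP[qq' /asboolP rq'] [eI eJ].
  have {}qq : quasi q by apply/quasisP; rewrite inE.
  apply/ffunP => x; pose z : {ffun 'I_n -> 'I_4} := [ffun=> o0].
  have zI w : cube I z w -> q w = q' w by apply: restrict_eq.
  pose w := mix I z x; have zw : cube I z w by apply: cube_mix.
  pose g t := q (upd z i0 t); have gI : injective g := @qq z i0.
  pose w' := upd z i0 (invF gI (q w)).
  have zw' : cube I z w' by apply: cube_upd => //; apply: cube_refl.
  have eq_w : q w = q w' by rewrite -/(g _) f_invF.
  have eq_w' : q' w = q' w' by rewrite -!zI.
  have xw : mix I x w = x.
    by apply/ffunP => i; rewrite mixE; case: ifP => // iI; rewrite /w mixE iI.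
  have := rq x z w w' zw zw' eq_w; have := rq' x z w w' zw zw' eq_w'.
  rewrite xw => -> ->; apply: restrict_eq eJ _; apply/cubeP => i.
  rewrite !inE negb_or negbK mixE => /andP[ii0 ->].
  by rewrite upd_other.
rewrite -(card_in_imset Phi_inj).
apply: leq_trans (subset_leq_card (_ : _ \subset setX (quasis _) (quasis _))) _.
  apply/subsetP => p /imsetP[q]; rewrite inE => /andP[qq _] ->{p}.
  by rewrite inE /= !restrict_quasi.
by rewrite cardsX -cJ leq_mul ?card_restrict.
Qed.

(** * Counting semilinear quasigroups *)

Definition nxt (c : 'I_3) : 'I_3 := if c == c0 then c1 else c0.

Lemma nxt_neq c : nxt c != c.
Proof. by rewrite /nxt; case: (eqVneq c c0) => [->|]; rewrite // eq_sym. Qed.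

(** The symbol with bits [b] and [b'] in the colours [c] and [nxt c]. *)
Definition mk (c : 'I_3) (b b' : bool) : 'I_4 :=
  let a := if b' then swp c o0 else o0 in if b then swp (nxt c) a else a.

Lemma pr_mk c b b' : pr c (mk c b b') = b.
Proof.
by rewrite /mk; case: b; case: b'; rewrite ?pr_swp ?pr_o0 ?eqxx ?nxt_neq // eq_sym nxt_neq.
Qed.

Lemma pr_nxt_mk c b b' : pr (nxt c) (mk c b b') = b'.
Proof.
by rewrite /mk; case: b; case: b'; rewrite ?pr_swp ?pr_o0 ?eqxx ?nxt_neq.
Qed.

Lemma mk_pr c a b b' : pr c a = b -> pr (nxt c) a = b' -> mk c b b' = a.
Proof.
move=> e e'; apply: (@pr_inj c (nxt c)); rewrite ?pr_mk ?pr_nxt_mk //.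
by rewrite eq_sym nxt_neq.
Qed.

Section Semilinear.
Variable n : nat.
Implicit Types (a : {ffun 'I_n -> 'I_3}) (x : {ffun 'I_n -> 'I_4}) (t : {ffun 'I_n -> bool}).

Let z : {ffun 'I_n -> 'I_4} := [ffun=> o0].

Definition bits a x : {ffun 'I_n -> bool} := [ffun i => pr (a i) (x i)].
Definition rep a t : {ffun 'I_n -> 'I_4} := [ffun i => mk (a i) (t i) false].
Definition lin a x : bool := \big[addb/false]_i pr (a i) (x i).
Definition nxts a : {ffun 'I_n -> 'I_3} := [ffun i => nxt (a i)].

Lemma bits_rep a t : bits a (rep a t) = t.
Proof. by apply/ffunP => i; rewrite !ffunE pr_mk. Qed.

Lemma lin_upd a x i u : lin a (upd x i u) = lin a x (+) pr (a i) (x i) (+) pr (a i) u.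
Proof.
rewrite /lin (bigD1 i) //= (bigD1 i (F := fun i => pr (a i) (x i))) //= upd_same.
rewrite (eq_bigr (fun j => pr (a j) (x j))) => [|j ji]; last by rewrite upd_other.
by case: (pr _ _); case: (pr _ _); case: (\big[_/_]_(_ | _) _).
Qed.

Lemma lin0 a : lin a z = false.
Proof. by rewrite /lin big1 // => i _; rewrite ffunE pr_o0. Qed.

Lemma lin_bits a x y : bits a x = bits a y -> lin a x = lin a y.
Proof. by move=> /ffunP e; apply: eq_bigr => i _; have := e i; rewrite !ffunE. Qed.

Definition key := ('I_3 * {ffun 'I_n -> 'I_3} * bool)%type.
Definition param := (key * {ffun {ffun 'I_n -> bool} -> bool})%type.

(** Normal form for an additive colour [c]. The second colour is forced up to one bit on each class
    of words with equal [bits]; [F] chooses these $2^n$ bits freely. *)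
Definition semi (p : param) : {ffun {ffun 'I_n -> 'I_4} -> 'I_4} :=
  let: (c, a, e, F) := p in
  [ffun x => mk c (e (+) lin a x) (F (bits a x) (+) lin (nxts a) x)].

Definition colour (p : param) : 'I_3 := p.1.1.1.

Lemma card_key : #|{: key}| = 2 * 3 ^ n.+1.
Proof. by rewrite !card_prod card_bool card_ffun !card_ord mulnC expnS. Qed.

Lemma card_param : #|{: param}| = 3 ^ n.+1 * 2 ^ (2 ^ n).+1.
Proof.
rewrite card_prod card_key card_ffun card_bool card_ffun card_bool card_ord.
by rewrite [2 ^ _.+1]expnS mulnA (mulnC 2).
Qed.

Lemma semi_quasi p : semi p \in quasis 'I_n.
Proof.
case: p => [[[c a] e] F]; apply/quasisP => x i u v /=; rewrite !ffunE => E.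
have := congr1 (pr c) E; have := congr1 (pr (nxt c)) E.
rewrite !pr_mk !pr_nxt_mk => E2 /addbI; rewrite !lin_upd => /addbI E1.
have bE : bits a (upd x i u) = bits a (upd x i v).
  by apply/ffunP => j; rewrite !ffunE; case: eqP => [->|].
move: E2; rewrite bE => /addbI; rewrite !lin_upd ffunE => /addbI.
by apply: pr_inj E1; rewrite eq_sym nxt_neq.
Qed.

Lemma pr_semi p p' x : p.1 = p'.1 -> pr (colour p) (semi p x) = pr (colour p) (semi p' x).
Proof.
by case: p => [[[c a] e] F]; case: p' => [k F'] /= <-; rewrite !ffunE !pr_mk.
Qed.

Lemma semi_inj p p' : colour p = colour p' -> semi p = semi p' -> p = p'.
Proof.
case: p => [[[c a] e] F]; case: p' => [[[c' a'] e'] F']; rewrite /colour /= => <-{c'} /ffunP E.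
have E1 x : e (+) lin a x = e' (+) lin a' x.
  by have := congr1 (pr c) (E x); rewrite !ffunE !pr_mk.
have ee : e = e' by have := E1 z; rewrite !lin0 !addbF.
have aa : a = a'.
  apply/ffunP => i; apply: pr_same => u; have := E1 (upd z i u).
  by rewrite ee => /addbI; rewrite !lin_upd !lin0 !ffunE !pr_o0.
congr (_, _, _, _) => //; apply/ffunP => t.
have := congr1 (pr (nxt c)) (E (rep a t)); rewrite !ffunE !pr_nxt_mk -aa => /addIb.
by rewrite bits_rep.
Qed.

(* Two parameters of different colours giving the same quasigroup fix two of its colour functions,
   so that colliding parameters are determined by a pair of keys. *)
Lemma card_semi_ge : #|{: param}| <= #|codom semi| + #|{: key}| ^ 2.
Proof.
pose other p := odflt p [pick p' | (p' != p) && (semi p' == semi p)].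
pose B := [set p | other p != p].
have BP p : p \in B -> semi (other p) = semi p /\ colour (other p) != colour p.
  rewrite inE /other; case: pickP => [p' /andP[pp' /eqP e] _|]; last by rewrite eqxx.
  by split=> //; apply: contra pp' => /eqP cc; apply/eqP/semi_inj.
have Binj : {in B &, injective (fun p => (p.1, (other p).1))}.
  move=> p1 p2 /BP[s1 c1] /BP[s2 _] [k k'].
  have cc : colour p1 = colour p2 by rewrite /colour k.
  apply: semi_inj => //; apply/ffunP => x; apply: (pr_inj c1).
    by rewrite -{1}s1 -s2; apply: pr_semi.
  exact: pr_semi.
have Cinj : {in ~: B &, injective semi}.
  move=> p p'; rewrite !inE negbK => /eqP o _ e; apply/eqP/negPn/negP => ne; move: o.
  rewrite /other; case: pickP => [p'' /andP[h _] /= o|/(_ p')]; first by rewrite o eqxx in h.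
  by rewrite e eqxx eq_sym ne.
rewrite -(cardsC B) addnC leq_add //.
  rewrite -(card_in_imset Cinj) subset_leq_card //; apply/subsetP => q /imsetP[p _ ->].
  exact: codom_f.
by rewrite -(card_in_imset Binj) -mulnn -card_prod max_card.
Qed.

Section Completeness.
Variables (q : {ffun {ffun 'I_n -> 'I_4} -> 'I_4}) (c : 'I_3).
Hypotheses (qq : quasi q) (cadd : forall i j x, i != j -> add (D q c) i j x).

(** The change along [i] is the same in every context, and a balanced function on four symbols is a
    colour up to complement; the partner [a'] of [o0] tells which. *)
Lemma slope i : exists d, forall x u v, 
  D q c (upd x i u) (+) D q c (upd x i v) = pr d u (+) pr d v.
Proof.
pose g u := D q c (upd z i u).
have [a' [ne ga hb]] := D_balanced qq c z i o0.
have [d da] : exists d, pr d a' = false.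
  by move: a' ne {ga hb}; apply: ord4_ind => //; [exists c1|exists c0|exists c2].
have gE u : g u = g o0 (+) pr d u.
  case: (eqVneq u o0) => [->|u0]; first by rewrite pr_o0 addbF.
  case: (eqVneq u a') => [->|ua]; first by rewrite da addbF.
  rewrite /g hb //; suff -> : pr d u by rewrite addbT.
  apply/negPn/negP => /negPf du; move/eqP: ua; apply.
  have -> : u = swp d o0 by apply: pr_eq_neq => //; rewrite pr_o0 du.
  by apply/esym; apply: pr_eq_neq => //; rewrite pr_o0 da.
exists d => x u v.
have : D q c (upd x i u) (+) D q c (upd x i v) = g u (+) g v.
  pose P x := D q c (upd x i u) (+) D q c (upd x i v) = g u (+) g v.
  have zx : cube setT z x by apply/cubeP => j; rewrite inE.
  apply: (cube_ind (P := P) _ _ zx) => [//|]; rewrite /P.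
    move=> w j _ _ <-; case: (eqVneq i j) => [->|ij]; first by rewrite !upd_upd.
    have /addP/(_ u (x j) v (w j)) := cadd w ij.
    have uw b : upd (upd w i b) j (w j) = upd w i b by rewrite upd_fix // upd_other // eq_sym.
    by rewrite !uw !(updC _ _ _ ij).
by move=> ->; rewrite (gE u) (gE v) addbACA addbb.
Qed.

(** Moving [w i] to its partner in the colour [a i] keeps the colour [c] of the value, hence flips
    its second colour, and also flips [lin (nxts a)]. So [H] depends on the bits alone. *)
Lemma semi_complete : exists p, q = semi p.
Proof.
have [a ha] : exists a : {ffun 'I_n -> 'I_3}, forall i x u v,
    D q c (upd x i u) (+) D q c (upd x i v) = pr (a i) u (+) pr (a i) v.
  have [a ha] := fin_all_exists slope.
  by exists [ffun i => a i] => i x u v; rewrite ffunE.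
have full x y : cube [set: 'I_n] x y by apply/cubeP => j; rewrite inE.
have qc x : D q c x = D q c z (+) lin a x.
  apply: (cube_ind (P := fun x => D q c x = D q c z (+) lin a x)) (full z x).
    by rewrite lin0 addbF.
  move=> w i _ _ IH; have := ha i w (x i) (w i); rewrite upd_id lin_upd.
  move=> /(canRL (addbK _)) ->; rewrite IH.
  by case: (pr _ (x i)); case: (pr _ (w i)); case: (lin a w); case: (D q c z).
pose H x := pr (nxt c) (q x) (+) lin (nxts a) x.
have HE x y : bits a x = bits a y -> H x = H y.
  move=> xy; suff [] : bits a y = bits a y /\ H x = H y by [].
  apply: (cube_ind (P := fun w => bits a w = bits a y /\ H x = H w)) (full x y) => //.
  move=> w i _ _ [by_ ->].
  have yi : pr (a i) (w i) = pr (a i) (y i) by have /ffunP/(_ i) := by_; rewrite !ffunE.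
  have by' : bits a (upd w i (y i)) = bits a y.
    by rewrite -by_; apply/ffunP => j; rewrite !ffunE; case: eqP => [->|].
  split=> //; case: (eqVneq (y i) (w i)) => [->|ne]; first by rewrite upd_id.
  have nc : nxt (a i) != a i := nxt_neq _.
  have e1 : pr (nxt (a i)) (y i) = ~~ pr (nxt (a i)) (w i).
    by rewrite (pr_eq_neq yi ne) pr_swp nc addbT.
  have e2 : pr (nxt c) (q (upd w i (y i))) = ~~ pr (nxt c) (q w).
    apply: bool_neq => e; move/eqP: ne; apply; apply: (@qq w i); rewrite upd_id.
    apply: (@pr_inj c (nxt c)) => //; first by rewrite eq_sym nxt_neq.
    by rewrite -/(D q c _) -/(D q c w) qc [RHS]qc; congr (_ (+) _); apply: lin_bits; rewrite by_.
  rewrite /H lin_upd ffunE e1 e2.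
  by case: (pr _ (q w)); case: (pr _ (w i)); case: (lin _ w).
exists (c, a, D q c z, [ffun t => H (rep a t)]); apply/ffunP => x; rewrite !ffunE.
apply/esym/mk_pr; first exact: qc.
by rewrite (HE _ x) ?bits_rep // /H addbK.
Qed.
End Completeness.
End Semilinear.

Lemma Q_lower n : 3 ^ n.+1 * 2 ^ (2 ^ n).+1 <= Q n + (2 * 3 ^ n.+1) ^ 2.
Proof.
rewrite -card_param -card_key; apply: leq_trans (card_semi_ge n) _; rewrite leq_add2r.
rewrite -card_quasis; apply/subset_leq_card/subsetP => q /codomP[p ->]; exact: semi_quasi.
Qed.

Lemma Q_upper n : Q n <= 3 ^ n.+1 * 2 ^ (2 ^ n).+1 +
  \sum_(I : {set 'I_n} | 1 < #|I| < n) Q #|I| * Q (n - #|I|).+1.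
Proof.
pose R I := [set q in quasis 'I_n | `[< reduces q I >]].
have sub : quasis 'I_n \subset [set semi p | p : param n] :|:
    \bigcup_(I : {set 'I_n} | 1 < #|I| < n) R I.
  apply/subsetP => q qQ; have qq := quasisP _ qQ; rewrite inE.
  have [[c cadd]|[I [I1 IT Ired]]] := semilinear_or_reducible qq.
    have [p ->] := semi_complete qq cadd; by rewrite imset_f.
  apply/orP; right; apply/bigcupP; exists I; last by rewrite inE qQ; apply/asboolP.
  rewrite I1 -[X in _ < X]card_ord -cardsT; apply: proper_card.
  by rewrite properEneq IT subsetT.
rewrite -card_quasis; apply: leq_trans (subset_leq_card sub) _.
apply: leq_trans (leq_card_setU _ _) _; apply: leq_add.
  by rewrite -card_param leq_imset_card.
apply: leq_trans (_ : _ <= \sum_(I : {set 'I_n} | 1 < #|I| < n) #|R I|) _.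
  elim/big_rec2: _ => [|I A B _ AB]; first by rewrite cards0.
  by apply: leq_trans (leq_card_setU _ _) _; rewrite leq_add2l.
by apply: leq_sum => I /andP[I1 _]; apply: card_reduces; apply: ltnW.
Qed.

(** * Asymptotics *)

Definition nsemi n := 3 ^ n.+1 * 2 ^ (2 ^ n).+1.

(** A crude union bound over at most $2^n$ sets [I] accounts for the [n] in the exponent. *)
Lemma Q_upper_exp n (b : nat -> nat) B :
    (forall k, 1 < k < n -> Q k <= 2 ^ b k) ->
    (forall k, 1 < k < n -> b k + b (n - k).+1 <= B) ->
  Q n <= nsemi n + 2 ^ (n + B).
Proof.
move=> Qb bB; apply: leq_trans (Q_upper n) _; rewrite leq_add2l expnD.
apply: (@leq_trans (\sum_(I : {set 'I_n} | 1 < #|I| < n) 2 ^ B)).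
  apply: leq_sum => I In; apply: (@leq_trans (2 ^ b #|I| * 2 ^ b (n - #|I|).+1)).
    by apply: leq_mul; apply: Qb => //; lia.
  by rewrite -expnD leq_exp2l // bB.
rewrite sum_nat_const leq_mul2r; apply/orP; right; apply: leq_trans (max_card _) _.
by rewrite -cardsT -powersetT card_powerset cardsT card_ord.
Qed.

(** Amounts to $3^{n+1} \le 2^{2n+1}$, which fails at [n = 1]. *)
Lemma nsemi_le n : 1 < n -> nsemi n <= 2 ^ (2 ^ n + 2 * n + 2).
Proof.
case: n => [//|[//|n _]]; have -> : 2 ^ n.+2 + 2 * n.+2 + 2 = 2 * n + 5 + (2 ^ n.+2).+1 by lia.
rewrite expnD leq_mul2r; apply/orP; right.
elim: n => [//|n IH]; rewrite [3 ^ _]expnS.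
have -> : 2 * n.+1 + 5 = 2 + (2 * n + 5) by lia.
rewrite expnD; lia.
Qed.

(** With [x] and [y] as in the proof this is $(x-1)(y-1) \ge 0$; equality holds at the ends [k = 2]
    and [k = n - 1]. *)
Lemma exp2_convex n k : 1 < k < n -> 2 ^ k + 2 ^ (n - k).+1 <= 4 + 2 ^ n.-1.
Proof.
move=> kn; have -> : 2 ^ k = 4 * 2 ^ (k - 2) by rewrite -(expnD 2 2); congr (2 ^ _); lia.
have -> : 2 ^ (n - k).+1 = 4 * 2 ^ (n - k - 1) by rewrite -(expnD 2 2); congr (2 ^ _); lia.
have -> : 2 ^ n.-1 = 4 * (2 ^ (k - 2) * 2 ^ (n - k - 1)).
  by rewrite -expnD -(expnD 2 2); congr (2 ^ _); lia.
have : 0 < 2 ^ (k - 2) by rewrite expn_gt0.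
have : 0 < 2 ^ (n - k - 1) by rewrite expn_gt0.
move: (2 ^ (k - 2)) (2 ^ (n - k - 1)) => x y; nia.
Qed.

Lemma exp2_lower n m : m <= n -> (n - m).+1 * 2 ^ m <= 2 ^ n.
Proof.
move=> mn; rewrite -{2}(subnK mn) expnD leq_mul2r; apply/orP; right; exact: ltn_expl.
Qed.

(* The general term of [expo] satisfies the recursion from [n = 6] on; the first values
   are what the recursion gives from [Q 2 <= 2 ^ 11]. *)
Definition expo k := if k == 2 then 11 else if k == 3 then 26 else 2 ^ k + 2 * k + 18.

Lemma expo_le k : 1 < k -> expo k <= 2 ^ k + 2 * k + 18.
Proof. by rewrite /expo; case: eqP => [->|_] //; case: eqP => [->|_]. Qed.

(** Here [42 = 4 + 2 + 2 * 18]: the 4 comes from [exp2_convex], the 2 from the sizes adding up to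
    [n + 1]. *)
Lemma expo_sum n k : 1 < k < n -> expo k + expo (n - k).+1 <= 2 ^ n.-1 + 2 * n + 42.
Proof.
move=> kn; have := exp2_convex kn.
have := @expo_le k; have := @expo_le (n - k).+1; lia.
Qed.

Lemma Q_expo n : 1 < n -> Q n <= 2 ^ expo n.
Proof.
elim/ltn_ind: n => n IH n1.
(* Each summand is to be at most half of the bound, hence 3 instead of the 2 in [nsemi_le], and the
   strict inequality. *)
suff [B hB [e1 e2]] : exists2 B, forall k, 1 < k < n -> expo k + expo (n - k).+1 <= B &
    2 ^ n + 2 * n + 3 <= expo n /\ n + B < expo n.
  have Qb k : 1 < k < n -> Q k <= 2 ^ expo k by move=> /andP[k1 kn]; apply: IH.
  apply: leq_trans (Q_upper_exp Qb hB) _.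
  have h : 0 < expo n by lia.
  rewrite -(prednK h) [2 ^ _.+1]expnS mul2n -addnn leq_add //.
    by apply: leq_trans (nsemi_le n1) _; rewrite leq_exp2l //; lia.
  by rewrite leq_exp2l //; lia.
(* The requirement is $n + 24 < 2^{n-1}$, true from 6 on. *)
have [n6|n6] := leqP 6 n.
  exists (2 ^ n.-1 + 2 * n + 42); first exact: expo_sum.
  rewrite /expo !ifN; try lia.
  have : 2 ^ n = 2 * 2 ^ n.-1 by rewrite -expnS prednK //; lia.
  have /exp2_lower : 5 <= n.-1 by lia.
  by rewrite -[2 ^ 5]/32; lia.
have [n5|[n5|[n5|n5]]] : n = 2 \/ n = 3 \/ n = 4 \/ n = 5 by lia.
all: rewrite n5.
- by exists 0 => // k; lia.
- by exists 22 => // k kn; have -> : k = 2 by lia.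
- by exists 37 => // k kn; have [->|->] : k = 2 \/ k = 3 by lia.
- by exists 53 => // k kn; have [->|[->|->]] : k = 2 \/ k = 3 \/ k = 4 by lia.
Qed.

(** An absolute error $O(2^{2^n})$ is enough, [nsemi n] being $6 \cdot 3^n \cdot 2^{2^n}$. The
    exponent 70 is generous; it covers the linear terms for small [n]. *)
Lemma Q_asymptotics : exists C, forall n,
  Q n <= nsemi n + C * 2 ^ 2 ^ n /\ nsemi n <= Q n + C * 2 ^ 2 ^ n.
Proof.
pose C := 2 ^ 70; exists C => n; split.
  have Qb k : 1 < k < n -> Q k <= 2 ^ expo k by move=> /andP[k1 _]; apply: Q_expo.
  apply: leq_trans (Q_upper_exp Qb (@expo_sum n)) _.
  rewrite leq_add2l -expnD leq_exp2l //.
  case: n {Qb} => [//|n]; rewrite [2 ^ n.+1]expnS /=.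
  have [n3|n3] := leqP 3 n.
    have /exp2_lower := n3; rewrite -[2 ^ 3]/8; lia.
  by lia.
apply: leq_trans (Q_lower n) _; rewrite leq_add2l.
(* The square of $2 \cdot 3^{n+1} \le 2^{2n+3}$. *)
apply: (@leq_trans (2 ^ (4 * n + 6))).
  have -> : 4 * n + 6 = (2 * n + 3) * 2 by lia.
  rewrite [2 ^ _]expnM leq_exp2r // expnD (expnM 2 2) -[2 ^ 2]/4 -[2 ^ 3]/8 expnS.
  have : 3 ^ n <= 4 ^ n by case: n => [//|n]; rewrite leq_exp2r.
  lia.
rewrite -expnD leq_exp2l //.
have [n3|n3] := leqP 3 n; last by lia.
have /exp2_lower := n3; rewrite -[2 ^ 3]/8; lia.
Qed.

(* The relative error over the reals *)
From mathcomp Require Import all_order all_algebra all_classical all_reals all_analysis.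
Import Order.TTheory GRing.Theory Num.Theory.
Import numFieldNormedType.Exports.

Local Open Scope classical_set_scope.
Local Open Scope ring_scope.

Theorem mainTheorem1 (R : realType) :
  exists2 eps : nat -> R,
    eps =O_\oo (fun n : nat => 1 / 3 ^+ n : R) &
    forall n : nat,
      (Q n)%:R = 3 ^+ (n + 1) * 2 ^+ (2 ^ n + 1) * (1 + eps n) :> R.
Proof.
have [C hC] := Q_asymptotics.
pose M n : R := 3 ^+ (n + 1) * 2 ^+ (2 ^ n + 1).
have M0 n : 0 < M n by rewrite mulr_gt0 ?exprn_gt0.
have ME n : M n = (nsemi n)%:R by rewrite /M natrM !natrX !addn1.
exists (fun n => (Q n)%:R / M n - 1); last first.
  by move=> n; rewrite -/(M n) subrKC mulrC divfK // gt_eqF.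
(* The constant has to be positive, and [C] might be zero. *)
apply/eqO_exP; exists (C%:R + 1); first by rewrite ltr_wpDl.
apply: nearW => n.
have [up lo] := hC n.
have E : (Q n)%:R / M n - 1 = ((Q n)%:R - M n) / M n by rewrite mulrBl divff // gt_eqF.
rewrite E normrM normfV (gtr0_norm (M0 n)) ler_pdivrMr //.
have le : `|(Q n)%:R - M n| <= (C * 2 ^ 2 ^ n)%:R.
  by rewrite ME ler_norml lerBrDr addrC !lerBlDr -!natrD !ler_nat (addnC (C * _)%N) up lo.
apply: le_trans le _.
rewrite natrM natrX ger0_norm ?divr_ge0 ?exprn_ge0 // /M !exprD !expr1 mul1r.
set b := 2 ^+ (2 ^ n)%N.
have b0 : 0 <= b by rewrite exprn_ge0.
rewrite -!mulrA mulKf ?gt_eqF ?exprn_gt0 // ler_pM // ?lerDl // mulrCA ler_peMr //.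
by rewrite -natrM ler1n.
Qed.
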